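(* Let $(V,p,e)$ be a hyperbolic system of degree $n$. Suppose $\{c_1,c_2,\ldots,c_n\}$ is a Jordan frame, $\mathbf{A}=[a_1,a_2,\ldots,a_n]$ is an $e$-doubly stochastic $n$-tuple, and $D=[d_{ij}]$ is an $n\times n$ doubly stochastic matrix. Consider the linear transformation $T:V\to V$ given by $$T(x)=\sum_{i=1}^{n}\sum_{j=1}^{n}d_{ij}\,\langle x,a_j\rangle\,c_i\qquad(x\in V).$$ Then $T$ is doubly stochastic on $(V,p,e)$ and $\lambda(T(x))\prec\lambda(x)$ for all $x\in V$.
   Context: Let $V$ be a finite-dimensional real vector space and $e\in V$ nonzero. A homogeneous polynomial $p$ of degree $n$ on $V$ is hyperbolic in the direction $e$ if $p(e)\ne 0$ and for every $x\in V$ the univariate polynomial $t\mapsto p(te-x)$ has only real zeros; then $(V,p,e)$ is called a hyperbolic system of degree $n$. Standing assumption: $n\ge 2$. The eigenvalue map $\lambda:V\to\mathbb{R}^n$ sends $x$ to the vector of roots of $t\mapsto p(te-x)$, with multiplicity, in decreasing order. The hyperbolicity cone is $\Lambda_+=\{x\in V:\lambda(x)\ge 0\}$ (entrywise). The semi-inner product on $V$ is $\langle x,y\rangle=\frac14\big[\|\lambda(x+y)\|^2-\|\lambda(x-y)\|^2\big]$ with the Euclidean norm on $\mathbb{R}^n$ (it is known that this is bilinear with $\langle x,x\rangle=\|\lambda(x)\|^2\ge 0$). The trace is $\operatorname{tr}(x)=\langle x,e\rangle$, which equals the sum of the entries of $\lambda(x)$. A primitive idempotent is an element $c$ with $\lambda(c)=(1,0,\ldots,0)^T$;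 a Jordan frame is a finite family of primitive idempotents with sum $e$. An $n$-tuple $[a_1,\ldots,a_n]$ of elements of $V$ is $e$-doubly stochastic if $a_i\in\Lambda_+$ and $\operatorname{tr}(a_i)=1$ for all $i$, and $a_1+\cdots+a_n=e$. A linear map $T:V\to V$ is doubly stochastic on $(V,p,e)$ if $T(\Lambda_+)\subseteq\Lambda_+$, $T(e)=e$, and $\operatorname{tr}(T(x))=\operatorname{tr}(x)$ for all $x\in V$. A doubly stochastic matrix is a nonnegative square matrix with all row and column sums equal to one. For $u,v\in\mathbb{R}^n$ with decreasing rearrangements $u^\downarrow,v^\downarrow$, $u\prec v$ (majorization) means $\sum_{i=1}^k u_i^\downarrow\le\sum_{i=1}^k v_i^\downarrow$ for $1\le k\le n$, with equality for $k=n$. *)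

(* Defs.v *)
From HB Require Import structures.
From mathcomp Require Import all_boot all_order all_algebra.
From mathcomp Require Import reals polyrcf complex mpoly.

Set Implicit Arguments.
Unset Strict Implicit.
Unset Printing Implicit Defensive.

Import Order.TTheory GRing.Theory Num.Theory.

Local Open Scope ring_scope.

(** Polynomials on a finite-dimensional space [V] are multivariate polynomials
    in the coordinates with respect to the fixed basis [vbasis {:V}]; neither
    the polynomial functions so obtained nor homogeneity depends on the basis. *)
Definition polyOn (R : realType) (V : vectType R) : Type :=
  {mpoly R[\dim {:V}]}.

Definition evalOn (R : realType) (V : vectType R) (p : polyOn V) (x : V) : R :=
  p.@[fun i => coord (vbasis {:V}) i x].

(** The univariate polynomial [t |-> p (t e - x)]; see [hornerPencil]. *)
Definition pencil (R : realType) (V : vectType R) (p : polyOn V) (e x : V) :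
    {poly R} :=
  mmap (@polyC R)
    (fun i => (coord (vbasis {:V}) i e)%:P * 'X
              - (coord (vbasis {:V}) i x)%:P) p.

Lemma hornerPencil (R : realType) (V : vectType R) (p : polyOn V) (e x : V)
    (t : R) :
  (pencil p e x).[t] = evalOn p (t *: e - x).
Proof.
rewrite /pencil /evalOn /meval /mmap horner_sum; apply: eq_bigr => m _.
rewrite hornerM hornerC /mmap1 horner_prod; congr (_ * _).
apply: eq_bigr => i _.
by rewrite horner_exp !hornerE linearB linearZ /= mulrC.
Qed.

Definition only_real_zeros (R : realType) (q : {poly R}) : Prop :=
  forall z : R[i], root (map_poly (real_complex R) q) z -> complex.Im z = 0.

Definition hyperbolic_system (R : realType) (V : vectType R) (n : nat)
    (p : polyOn V) (e : V) : Prop :=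
  [/\ e != 0, p \is n.-homog, evalOn p e != 0
    & forall x : V, only_real_zeros (pencil p e x)].

Definition real_roots (R : realType) (q : {poly R}) : seq R :=
  sort >=%R (flatten [seq nseq (mup a q) a | a <- rootsR q]).

(** For a hyperbolic system of degree [n] the list of roots has length exactly
    [n], so the default value of the indexing is never used. *)
Definition lambda (R : realType) (V : vectType R) (n : nat) (p : polyOn V)
    (e x : V) : 'rV[R]_n :=
  \row_(i < n) (real_roots (pencil p e x))`_i.

Definition hyp_cone (R : realType) (V : vectType R) (n : nat) (p : polyOn V)
    (e x : V) : Prop :=
  forall i : 'I_n, 0 <= lambda n p e x 0 i.

Definition sqnorm (R : realType) (n : nat) (u : 'rV[R]_n) : R :=
  \sum_(i < n) u 0 i ^+ 2.

Definition sip (R : realType) (V : vectType R) (n : nat) (p : polyOn V)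
    (e x y : V) : R :=
  4^-1 * (sqnorm (lambda n p e (x + y)) - sqnorm (lambda n p e (x - y))).

Definition htr (R : realType) (V : vectType R) (n : nat) (p : polyOn V)
    (e x : V) : R :=
  sip n p e x e.

Definition primitive_idempotent (R : realType) (V : vectType R) (n : nat)
    (p : polyOn V) (e c : V) : Prop :=
  lambda n p e c = \row_(i < n) (i == 0%N :> nat)%:R.

Definition jordan_frame (R : realType) (V : vectType R) (n : nat)
    (p : polyOn V) (e : V) (m : nat) (c : 'I_m -> V) : Prop :=
  (forall i, primitive_idempotent n p e (c i)) /\ \sum_(i < m) c i = e.

Definition ds_tuple (R : realType) (V : vectType R) (n : nat) (p : polyOn V)
    (e : V) (a : 'I_n -> V) : Prop :=
  [/\ forall i, hyp_cone n p e (a i),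
      forall i, htr n p e (a i) = 1
    & \sum_(i < n) a i = e].

Definition ds_map (R : realType) (V : vectType R) (n : nat) (p : polyOn V)
    (e : V) (T : V -> V) : Prop :=
  [/\ linear T,
      forall x, hyp_cone n p e x -> hyp_cone n p e (T x),
      T e = e
    & forall x, htr n p e (T x) = htr n p e x].

Definition ds_matrix (R : realType) (n : nat) (D : 'M[R]_n) : Prop :=
  [/\ forall i j, 0 <= D i j,
      forall i, \sum_(j < n) D i j = 1
    & forall j, \sum_(i < n) D i j = 1].

Definition dec_rearr (R : realType) (n : nat) (u : 'rV[R]_n) : seq R :=
  sort >=%R [seq u 0 i | i <- enum 'I_n].

Definition majorized (R : realType) (n : nat) (u v : 'rV[R]_n) : Prop :=
  (forall k : nat, (1 <= k <= n)%N ->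
     \sum_(0 <= i < k) (dec_rearr u)`_i <= \sum_(0 <= i < k) (dec_rearr v)`_i)
  /\ \sum_(0 <= i < n) (dec_rearr u)`_i = \sum_(0 <= i < n) (dec_rearr v)`_i.

(* Main.v *)
Require Import Defs.
From mathcomp Require Import all_boot all_order all_algebra.
From mathcomp Require Import reals.
From mathcomp Require Import boolp classical_sets polyrcf complex mpoly.
From mathcomp Require Import zify ring lra.

Set Implicit Arguments.
Unset Strict Implicit.
Unset Printing Implicit Defensive.

Import Order.TTheory GRing.Theory Num.Theory.
Local Open Scope ring_scope.

(** The map [T] has the form [x |-> \sum_i w_i *: c_i] with [w = D u] and
    [u_j = <x, a_j>].  The theorem holds because [lambda (T x)] is the image
    of [lambda x] under a doubly stochastic matrix [S = H^T D G]: positivity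
    and trace preservation follow at once, and majorization is the easy half
    of the Hardy-Littlewood-Polya theorem.

    The factor [G] expresses [u = G (lambda x)].  For [b] in the hyperbolicity
    cone, let [g t = p (t e - x)], with roots [lambda_r], and let [h] be the
    derivative of [p] in direction [b], evaluated at [t e - x].  The quotient
    [h / g] has only simple poles with nonnegative residues, so that
    [h = \sum_r weight_r g / (t - lambda_r)] with [weight_r >= 0] ([weightP]).
    Comparing the two highest coefficients gives [\sum_r weight_r = tr b] and
    [\sum_r weight_r lambda_r = <x, b>].  The weights are additive in [b], and
    equal to 1 for [b = e]; hence the weights of a doubly stochastic tuple form
    a doubly stochastic matrix ([ds_tuple_matrix]).

    The sign of the residues comes from Garding's theorem in the form of a
    half-plane property ([stability]): if all eigenvalues of [y] are positive,
    then [p (x + t e + s y) != 0] whenever [Im t > 0] and [Im s >= 0].  It is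
    proved by shrinking [x] to [0] and noting that no root [s] can cross the
    real axis on the way ([root_homotopy]).  A logarithmic derivative in [s]
    then shows that [h / g] maps the upper half-plane into the closed lower
    one, and such a rational function can only have simple poles with
    nonnegative residues ([residue_dvd_ge0]).

    The factor [H^T] expresses [lambda (\sum_i w_i *: c_i) = H^T w].  A Jordan
    frame of [n] elements is orthonormal, since
    [1 = <c_i, e> = 1 + \sum_(j != i) <c_i, c_j>] with nonnegative terms.  The
    frame is itself a doubly stochastic tuple, so that [w = H (lambda x')] for
    [x' = \sum_i w_i *: c_i], and orthonormality says that [w] and
    [lambda x'] have equal norm.  A doubly stochastic matrix that preserves
    the norm of a vector is undone on that vector by its transpose
    ([ds_isometry_transpose]). *)

(** * Substitution of affine arguments into multivariate polynomials *)

Section Substitution.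
Variables (N : nat) (R : comNzRingType).
Implicit Types (p : {mpoly R[N]}) (A B : comNzRingType).

Lemma eq_mmap A (h1 h2 : R -> A) (f1 f2 : 'I_N -> A) p :
  h1 =1 h2 -> f1 =1 f2 -> mmap h1 f1 p = mmap h2 f2 p.
Proof.
move=> eqh eqf; rewrite /mmap; apply: eq_bigr => m _.
by rewrite eqh (mmap1_eq _ eqf).
Qed.

Lemma rmorph_mmap A B (phi : {rmorphism A -> B}) (h : R -> A) (f : 'I_N -> A) p :
  phi (mmap h f p) = mmap (phi \o h) (phi \o f) p.
Proof.
rewrite /mmap rmorph_sum; apply: eq_bigr => m _.
rewrite rmorphM; congr (_ * _).
by rewrite /mmap1 rmorph_prod; apply: eq_bigr => i _; rewrite rmorphXn.
Qed.

Lemma mmap_homog A (h : R -> A) (f : 'I_N -> A) (k : A) n p :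
  p \is n.-homog -> mmap h (fun i => k * f i) p = k ^+ n * mmap h f p.
Proof.
move=> /dhomogP ph; rewrite /mmap mulr_sumr; apply: eq_big_seq => m /ph <-.
rewrite mulrCA; congr (_ * _).
rewrite /mmap1 /= mdegE -prodrXr -big_split /=.
by apply: eq_bigr => i _; rewrite exprMn.
Qed.

(** Unlike a statement about [size] and [lead_coef], this one lets [a] vanish,
    which makes it stable under sums and products. *)
Definition top_coef A (d : nat) (P : {poly A}) (a : A) :=
  (size P <= d.+1)%N /\ P`_d = a.

Lemma top_coefM A d1 d2 (P Q : {poly A}) a b :
  top_coef d1 P a -> top_coef d2 Q b -> top_coef (d1 + d2) (P * Q) (a * b).
Proof.
move=> [sP <-] [sQ <-]; split.
  by apply: leq_trans (size_polyMleq _ _) _; lia.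
have lt1 : (d1 < (d1 + d2).+1)%N by lia.
rewrite coefM (bigD1 (Ordinal lt1)) //= addKn big1 ?addr0 // => j jn.
have /negP jd : (j : nat) != d1 by apply: contra jn => /eqP jd; apply/eqP/val_inj.
case: (ltngtP j d1) jd => // jd _.
  by rewrite (nth_default 0 (leq_trans sQ _)) ?mulr0 //; lia.
by rewrite (nth_default 0 (leq_trans sP _)) ?mul0r.
Qed.

Lemma top_coefX A d (P : {poly A}) a k :
  top_coef d P a -> top_coef (d * k) (P ^+ k) (a ^+ k).
Proof.
move=> dP; elim: k => [|k IH].
  by rewrite muln0 !expr0; split; rewrite ?size_poly1 ?coef1.
by rewrite mulnS !exprS; apply: top_coefM.
Qed.

Lemma top_coef_sum A d (I : eqType) (r : seq I) (P : I -> {poly A}) (a : I -> A) :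
  (forall i, i \in r -> top_coef d (P i) (a i)) ->
  top_coef d (\sum_(i <- r) P i) (\sum_(i <- r) a i).
Proof.
move=> dP; split; last by rewrite coef_sum; apply: eq_big_seq => i /dP [].
rewrite big_seq; apply: (leq_trans (size_sum _ _ _)).
by apply/bigmax_leqP_seq => i _ /dP [].
Qed.

Lemma top_coef_linear A (a b : A) : top_coef 1 (a%:P + b *: 'X) b.
Proof.
split; last by rewrite coefD coefC coefZ coefX mulr1 add0r.
rewrite (leq_trans (size_polyD _ _)) // geq_max (leq_trans (size_polyC_leq1 _)) //.
by rewrite (leq_trans (size_scale_leq _ _)) // size_polyX.
Qed.

Lemma top_coef_mmap A (h : R -> A) (u v : 'I_N -> A) n p :
  p \is n.-homog ->
  top_coef n (mmap (polyC \o h) (fun i => (u i)%:P + (v i) *: 'X) p)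
    (mmap h v p).
Proof.
move=> /dhomogP ph; apply: top_coef_sum => m /ph <-.
rewrite -[X in top_coef X]add0n; apply: top_coefM.
  by split; rewrite ?coefC // size_polyC_leq1.
rewrite /= mdegE /mmap1.
elim/big_rec3: _ => [|i k P a _ dP]; first by split; rewrite ?size_poly1 ?coef1.
apply: top_coefM => //; rewrite -{1}[m i]mul1n.
exact/top_coefX/top_coef_linear.
Qed.

(** The directional derivative along [v]. *)
Definition dirD (v : 'I_N -> R) p : {mpoly R[N]} := \sum_i v i *: p^`M(i).

Lemma dirD_is_linear v : linear (dirD v).
Proof.
move=> k p q; rewrite /dirD scaler_sumr -big_split; apply: eq_bigr => i _ /=.
by rewrite mderivD mderivZ scalerDr !scalerA mulrC.
Qed.

Lemma dirD_comm v w p : dirD v (dirD w p) = dirD w (dirD v p).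
Proof.
rewrite /dirD.
under eq_bigr => i _ do rewrite (linear_sum (mderiv i)) scaler_sumr.
under [RHS]eq_bigr => i _ do rewrite (linear_sum (mderiv i)) scaler_sumr.
rewrite exchange_big; apply: eq_bigr => i _; apply: eq_bigr => j _ /=.
by rewrite !mderivZ !scalerA mulrC mderiv_comm.
Qed.

Lemma dhomog_mderiv n p i : p \is n.+1.-homog -> p^`M(i) \is n.-homog.
Proof.
move=> /dhomogP ph; apply/dhomogP => m; rewrite mcoeff_msupp mcoeff_mderiv => nz.
have /ph /= : (m + U_(i))%MM \in msupp p.
  by rewrite mcoeff_msupp; apply: contraNneq nz => ->; rewrite mul0rn.
by rewrite mdegD mdeg1 addn1 => -[].
Qed.

Lemma dhomog_dirD n v p : p \is n.+1.-homog -> dirD v p \is n.-homog.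
Proof. by move=> ph; apply: rpred_sum => i _; apply/rpredZ/dhomog_mderiv. Qed.

(** The chain rule along an affine line.  Both sides are derivations over the
    substitution morphism, so it is enough to compare them on variables. *)
Lemma deriv_mmap (A : comNzRingType) (h : {rmorphism R -> A}) (u : 'I_N -> A)
    (v : 'I_N -> R) p :
  (mmap (polyC \o h) (fun i => (u i)%:P + h (v i) *: 'X) p)^`() =
  mmap (polyC \o h) (fun i => (u i)%:P + h (v i) *: 'X) (dirD v p).
Proof.
pose L := mmap (polyC \o h) (fun i => (u i)%:P + h (v i) *: 'X).
rewrite -/(L p) -/(L (dirD v p)).
have LM q1 q2 : L (q1 * q2) = L q1 * L q2 by rewrite /L rmorphM.
have LD q1 q2 : L (q1 + q2) = L q1 + L q2 by rewrite /L rmorphD.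
have LC c : L c%:MP = (h c)%:P by rewrite /L mmapC.
have LZ c q : L (c *: q) = (h c)%:P * L q by rewrite -mul_mpolyC LM LC.
have LX i : L 'X_i = (u i)%:P + h (v i) *: 'X by rewrite /L mmapX mmap1U.
pose ok q := (L q)^`() = L (dirD v q).
have DD q1 q2 : dirD v (q1 + q2) = dirD v q1 + dirD v q2.
  by have := dirD_is_linear v 1 q1 q2; rewrite !scale1r.
have DZ c q : dirD v (c *: q) = c *: dirD v q.
  have D0 : dirD v 0 = 0 by rewrite /dirD big1 // => i _; rewrite mderiv0 scaler0.
  by have := dirD_is_linear v c q 0; rewrite D0 !addr0.
have DM q1 q2 : dirD v (q1 * q2) = dirD v q1 * q2 + q1 * dirD v q2.
  rewrite /dirD mulr_suml mulr_sumr -big_split; apply: eq_bigr => i _ /=.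
  by rewrite mderivM scalerDr scalerAl scalerAr.
have D1 : dirD v 1 = 0.
  by rewrite /dirD big1 // => i _; rewrite -mpolyC1 mderivC scaler0.
have okM q1 q2 : ok q1 -> ok q2 -> ok (q1 * q2).
  by rewrite /ok => o1 o2; rewrite LM derivM DM LD !LM o1 o2.
have ok1 : ok 1 by rewrite /ok D1 -mpolyC1 -mpolyC0 !LC derivC rmorph0.
have okX i : ok 'X_i.
  rewrite /ok LX derivD derivC derivZ derivX add0r alg_polyC.
  have -> : dirD v 'X_i = (v i)%:MP; last by rewrite LC.
  rewrite /dirD (bigD1 i) //= big1 => [|j ji]; rewrite mderivX mnm1E.
    by rewrite eqxx addr0 scale1r -{1}[U_(i)%MM]add0m addmK mpolyX0 alg_mpolyC.
  by rewrite eq_sym (negbTE ji) scale0r scaler0.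
have okXm m : ok 'X_[m].
  rewrite mpolyXE_id; apply: big_ind => // i _.
  by elim: (m i) => [|k IH]; rewrite ?expr0 // exprS; apply: okM.
rewrite -/(ok p); elim/mpolyind: p => [|c m p _ _ IH].
  by rewrite /ok -(scale0r 1) DZ !LZ rmorph0 !mul0r deriv0.
by rewrite /ok DD !LD derivD IH DZ !LZ -okXm derivM derivC mul0r add0r.
Qed.
End Substitution.
(** * Real-rooted univariate polynomials *)

Section RealRooted.
Variable R : realType.
Implicit Types (q : {poly R}).

Lemma only_real_zeros_factor q : q != 0 -> only_real_zeros q ->
  exists s : seq R, q = lead_coef q *: \prod_(a <- s) ('X - a%:P).
Proof.
move=> q0 qr; have [rs] := closed_field_poly_normal (map_poly (real_complex R) q).
rewrite lead_coef_map => qE.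
have rsr z : z \in rs -> z = (complex.Re z)%:C%C.
  move=> zrs; rewrite [LHS]complexE qr ?mulr0 ?addr0 // qE rootZ ?root_prod_XsubC //.
  by rewrite fmorph_eq0 lead_coef_eq0.
exists [seq complex.Re z | z <- rs].
apply: (map_poly_inj (real_complex R)); rewrite qE map_polyZ; congr (_ *: _).
rewrite big_map rmorph_prod; apply: eq_big_seq => z /rsr {1}->.
by rewrite rmorphB /= map_polyX map_polyC.
Qed.

Lemma real_roots_perm (c : R) (s : seq R) : c != 0 ->
  perm_eq (real_roots (c *: \prod_(a <- s) ('X - a%:P))) s.
Proof.
move=> c0; set q := c *: _; rewrite /real_roots perm_sort.
have P0 : \prod_(a <- s) ('X - a%:P) != 0 by rewrite monic_neq0 ?monic_prod_XsubC.
have q0 : q != 0 by rewrite scaler_eq0 negb_or c0.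
have mq a : mup a q = count_mem a s.
  rewrite /q -mul_polyC mupMr; first exact: mu_prod_XsubC.
  by rewrite rootE hornerC.
have mr a : (a \in rootsR q) = (a \in s).
  have := roots_on_rootsR q0 a; rewrite in_itv /= => <-.
  by rewrite rootZ // root_prod_XsubC.
have uq : uniq (rootsR q) by rewrite uniq_roots.
apply/allP => /= a _; apply/eqP.
rewrite count_flatten -map_comp.
under eq_map => b do rewrite /= count_nseq.
rewrite sumnE big_map; have [ain|ain] := boolP (a \in rootsR q).
  rewrite (bigD1_seq a) //= eqxx mul1n mq big1 ?addn0 // => b /negbTE ->.
  by rewrite mul0n.
rewrite big1_seq ?(count_memPn _) -?mr // => b /= bin.
by rewrite (_ : b == a = false) ?mul0n //; apply: contraNF ain => /eqP <-.
Qed.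

Lemma real_roots_sorted q : sorted >=%R (real_roots q).
Proof. by apply: sort_sorted => x y; apply: ge_total. Qed.

Lemma real_roots_factor q : q != 0 -> only_real_zeros q ->
  q = lead_coef q *: \prod_(a <- real_roots q) ('X - a%:P).
Proof.
move=> q0 qr; have [s qE] := only_real_zeros_factor q0 qr.
rewrite {1}qE; congr (_ *: _); apply: perm_big.
by rewrite perm_sym qE; apply: real_roots_perm; rewrite lead_coef_eq0.
Qed.
End RealRooted.
(** * Roots moving with a real parameter *)

Section Homotopy.
Variable R : realType.
Local Notation C := R[i].
Local Notation nc := (@ComplexField.Normc.normc R).
Local Notation Im := (@complex.Im R).
Implicit Types (z s : C) (t : R).

Lemma normc_ge0 z : 0 <= nc z.
Proof. by case: z => a b; apply: sqrtr_ge0. Qed.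

Lemma normc_gt0 z : z != 0 -> 0 < nc z.
Proof.
move=> z0; rewrite lt_neqAle normc_ge0 andbT eq_sym.
by apply: contra z0 => /eqP /ComplexField.Normc.eq0_normc ->.
Qed.

Lemma normcX z k : nc (z ^+ k) = nc z ^+ k.
Proof.
elim: k => [|k IH]; first by rewrite !expr0 ComplexField.Normc.normc1.
by rewrite !exprS ComplexField.Normc.normcM IH.
Qed.

Lemma normc_ge_Im z : `|Im z| <= nc z.
Proof.
by case: z => a b /=; rewrite -sqrtr_sqr ler_wsqrtr // lerDr sqr_ge0.
Qed.

Lemma normc_real t : nc t%:C%C = `|t|.
Proof. by rewrite /= expr0n addr0 sqrtr_sqr. Qed.

Lemma le_normc_sum (I : Type) (r : seq I) (f : I -> C) :
  nc (\sum_(i <- r) f i) <= \sum_(i <- r) nc (f i).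
Proof.
elim/big_rec2: _ => [|i y x _ le]; first by rewrite ComplexField.Normc.normc0.
by apply: le_trans (le_normcD _ _) _; rewrite lerD2l.
Qed.

Lemma poly_bounded_unit (Q : {poly C}) :
  exists2 B, 0 <= B & forall z, nc z <= 1 -> nc Q.[z] <= B.
Proof.
elim/poly_ind: Q => [|Q c [B B0 QB]].
  by exists 0 => // z _; rewrite horner0 ComplexField.Normc.normc0.
exists (B + nc c) => [|z z1]; first by rewrite addr_ge0 ?normc_ge0.
rewrite hornerMXaddC (le_trans (le_normcD _ _)) // lerD2r.
rewrite ComplexField.Normc.normcM -[B]mulr1.
by apply: ler_pM; rewrite ?normc_ge0 ?QB.
Qed.

Lemma poly_lipschitz_unit (Q : {poly C}) :
  exists2 L, 0 <= L & forall a b, nc a <= 1 -> nc b <= 1 ->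
    nc (Q.[a] - Q.[b]) <= L * nc (a - b).
Proof.
elim/poly_ind: Q => [|Q c [L L0 QL]].
  by exists 0 => // a b _ _; rewrite !horner0 subr0 ComplexField.Normc.normc0 mul0r.
have [B B0 QB] := poly_bounded_unit Q.
exists (L + B) => [|a b a1 b1]; first exact: addr_ge0.
rewrite !hornerMXaddC.
have -> : Q.[a] * a + c - (Q.[b] * b + c) = (Q.[a] - Q.[b]) * a + Q.[b] * (a - b).
  by ring.
rewrite (le_trans (le_normcD _ _)) // !ComplexField.Normc.normcM [leRHS]mulrDl lerD //.
  rewrite -[X in _ <= X]mulr1; apply: ler_pM; rewrite ?normc_ge0 ?QL //.
by rewrite ler_wpM2r ?normc_ge0 ?QB.
Qed.

(** Connectedness of the unit interval for locally constant properties: look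
    at the supremum of the points that satisfy [P]. *)
Lemma unit_interval_connected (P : R -> Prop) :
    P 0 ->
    (forall t, 0 <= t <= 1 -> exists2 d, 0 < d &
       forall t', 0 <= t' <= 1 -> `|t' - t| < d -> P t' <-> P t) ->
  P 1.
Proof.
move=> P0 loc; apply: contrapT => nP1.
pose S : set R := fun t => 0 <= t <= 1 /\ P t.
have S0 : S 0 by split=> //; rewrite lexx ler01.
have hS : has_sup S.
  by split; [exists 0 | exists 1 => t [/andP[]]].
have sup01 : 0 <= sup S <= 1.
  rewrite sup_upper_bound //=; apply: ge_sup; first by exists 0.
  by move=> t [/andP[]].
have [d d0 dP] := loc _ sup01.
have Psup : P (sup S).
  have [t [t01 Pt] tS] := sup_adherent d0 hS.
  apply/(dP t) => //; have := sup_upper_bound hS (conj t01 Pt); rewrite ltr_norml => ?.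
  by apply/andP; split; lra.
have sup1 : sup S < 1.
  rewrite lt_neqAle; case/andP: sup01 => _ ->; rewrite andbT.
  by apply/eqP => s1; apply: nP1; rewrite -s1.
pose t := Num.min 1 (sup S + d / 2).
have tle : t <= 1 /\ t <= sup S + d / 2 by rewrite !ge_min !lexx orbT.
have tgt : sup S < t by rewrite lt_min sup1 ltrDl divr_gt0.
have t01 : 0 <= t <= 1 by case/andP: sup01 => ? ?; apply/andP; split; lra.
have St : S t.
  by split=> //; apply/(dP t) => //; rewrite ltr_norml; apply/andP; split; lra.
by have := sup_upper_bound hS St; rewrite leNgt tgt.
Qed.

Lemma normc_prod_ge (rs : seq C) s (k : R) : 0 <= k ->
  (forall r, r \in rs -> k <= nc (s - r)) ->
  k ^+ size rs <= nc (\prod_(r <- rs) ('X - r%:P)).[s].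
Proof.
move=> k0; elim: rs => [|r rs IH] rsk.
  by rewrite big_nil hornerE ComplexField.Normc.normc1.
rewrite big_cons hornerM ComplexField.Normc.normcM exprS !hornerE.
apply: ler_pM => //; [exact: exprn_ge0 | by apply: rsk; rewrite mem_head|].
by apply: IH => r' r'in; apply: rsk; rewrite in_cons r'in orbT.
Qed.

(** The bound grows like [1 + |s|], so that it can absorb a perturbation of a
    polynomial of the same degree uniformly in the unbounded half-plane. *)
Lemma separated_from_lower_roots (rs : seq C) :
  (forall r, r \in rs -> Im r < 0) ->
  exists2 k : R, 0 < k & forall r s, r \in rs -> 0 <= Im s ->
    k * (1 + nc s) <= nc (s - r).
Proof.
elim: rs => [|r rs IH] rsI; first by exists 1.
have [|k k0 kP] := IH; first by move=> r' r'in; rewrite rsI // in_cons r'in orbT.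
have rI : Im r < 0 by rewrite rsI ?mem_head.
pose kr := - Im r / (1 + nc r - Im r).
have nr := normc_ge0 r.
have den0 : 0 < 1 + nc r - Im r by lra.
have kr0 : 0 < kr by rewrite divr_gt0 // oppr_gt0.
exists (Num.min k kr) => [|r' s]; first by rewrite lt_min k0.
rewrite in_cons => /orP[/eqP -> sI|r'in sI]; last first.
  apply: le_trans (kP _ _ r'in sI); rewrite ler_wpM2r ?ge_min ?lexx //.
  by rewrite addr_ge0 ?normc_ge0.
apply: (@le_trans _ _ (kr * (1 + nc s))).
  by rewrite ler_wpM2r ?ge_min ?lexx ?orbT // addr_ge0 ?normc_ge0.
have dle : - Im r <= nc (s - r).
  apply: le_trans (normc_ge_Im _); apply: le_trans (ler_norm _).
  by rewrite raddfB /=; lra.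
have tri : nc s <= nc r + nc (s - r) by rewrite -{1}[s](subrK r) addrC le_normcD.
rewrite /kr mulrAC ler_pdivrMr //; nra.
Qed.

(** The property that all roots lie in the open lower half-plane is locally
    constant in the parameter.  It is open because a product of [n] factors
    bounded below by a multiple of [1 + |s|] dominates a small perturbation of
    degree at most [n].  It is closed because a root with positive imaginary
    part, on which a perturbed polynomial takes a small value, forces the
    perturbed polynomial to have a root nearby. *)
Lemma root_homotopy (n : nat) (F : {poly {poly C}}) (c : C) :
    c != 0 -> (size F <= n.+1)%N -> F`_n = c%:P ->
    let f t := map_poly (horner_eval t%:C%C) F in
    (forall t s, 0 <= t <= 1 -> root (f t) s -> Im s != 0) ->
    (forall s, root (f 0) s -> Im s < 0) ->
  forall s, root (f 1) s -> Im s < 0.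
Proof.
move=> c0 sF Fn f noreal.
have fE t s : (f t).[s] = \sum_(k < n.+1) (F`_k).[t%:C%C] * s ^+ k.
  rewrite (@horner_coef_wide _ n.+1) ?(leq_trans (size_poly _ _)) //.
  by apply: eq_bigr => k _; rewrite coef_map.
have fn t : (f t)`_n = c by rewrite coef_map Fn /= /horner_eval hornerC.
have sf t : size (f t) = n.+1.
  apply/eqP; rewrite eqn_leq (leq_trans (size_poly _ _)) //=.
  by rewrite ltnNge; apply: contra c0 => /leq_sizeP/(_ n (leqnn _)); rewrite fn => ->.
have factor t : exists2 rs, size rs = n & f t = c *: \prod_(r <- rs) ('X - r%:P).
  have [rs fr] := closed_field_poly_normal (f t).
  have lc : lead_coef (f t) = c by rewrite lead_coefE sf.
  exists rs; last by rewrite {1}fr lc.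
  by have := sf t; rewrite {1}fr lc size_scale // size_prod_XsubC => -[].
have rootf t rs s : f t = c *: \prod_(r <- rs) ('X - r%:P) ->
    root (f t) s = (s \in rs).
  by move=> ->; rewrite rootZ // root_prod_XsubC.
have cn := normc_gt0 c0.
have [L L0 fL] : exists2 L : R, 0 <= L & forall t t' s,
    0 <= t <= 1 -> 0 <= t' <= 1 ->
    nc ((f t').[s] - (f t).[s]) <= L * `|t' - t| * (1 + nc s) ^+ n.
  have lip (k : nat) := poly_lipschitz_unit F`_k.
  pose L k := s2val (cid2 (lip k)).
  exists (\sum_(k < n.+1) L k).
    by apply: sumr_ge0 => k _; rewrite /L; case: cid2.
  move=> t t' s t01 t01'; rewrite !fE -sumrB !mulr_suml.
  apply: le_trans (le_normc_sum _ _) _; apply: ler_sum => k _.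
  rewrite -mulrBl ComplexField.Normc.normcM normcX.
  have u1 : 1 <= 1 + nc s by rewrite lerDl normc_ge0.
  apply: ler_pM; rewrite ?exprn_ge0 ?normc_ge0 //.
    rewrite /L; case: cid2 => l l0 /= lP.
    rewrite -normc_real rmorphB; apply: lP; rewrite normc_real ger0_norm; lra.
  apply: (@le_trans _ _ ((1 + nc s) ^+ k)).
    by rewrite lerXn2r ?nnegrE ?normc_ge0 ?addr_ge0 ?normc_ge0 // lerDr ler01.
  by rewrite ler_weXn2l // -ltnS ltn_ord.
move=> f0; apply: (unit_interval_connected (P := fun t =>
  forall s, root (f t) s -> Im s < 0) f0) => t t01.
 have [allneg|] := pselect (forall s, root (f t) s -> Im s < 0).
  have [rs srs ft] := factor t.
  have [|k k0 kP] := @separated_from_lower_roots rs.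
    by move=> r rin; apply: allneg; rewrite (rootf _ _ _ ft).
  pose m := nc c * k ^+ n; have m0 : 0 < m by rewrite mulr_gt0 ?exprn_gt0.
  exists (m / (L + 1)) => [|t' t01' tt']; first by rewrite divr_gt0 // ltr_wpDl.
  split=> // _ s rs'; rewrite ltNge; apply/negP => sI.
  have u0 : 0 < 1 + nc s by rewrite ltr_pwDl ?normc_ge0.
  have lo : m * (1 + nc s) ^+ n <= nc (f t).[s].
    rewrite ft hornerZ ComplexField.Normc.normcM /m -mulrA ler_wpM2l ?(ltW cn) //.
    rewrite -exprMn -srs; apply: normc_prod_ge; last by move=> r rin; apply: kP.
    by rewrite mulr_ge0 ?ltW.
  have hi := fL _ _ s t01' t01; rewrite (eqP rs') subr0 in hi.
  have := le_trans lo hi; rewrite ler_pM2r ?exprn_gt0 // leNgt => /negP; apply.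
  rewrite distrC in tt' *; rewrite ltr_pdivlMr ?ltr_wpDl // in tt'.
  by have := normr_ge0 (t' - t); rewrite distrC; nra.
move=> /existsNP [s0] /not_implyP [rs0 /negP]; rewrite -leNgt => sI.
have {}sI : 0 < Im s0 by rewrite lt_neqAle eq_sym (noreal _ _ t01 rs0).
pose m := nc c * Im s0 ^+ n; have m0 : 0 < m by rewrite mulr_gt0 ?exprn_gt0.
pose u := (1 + nc s0) ^+ n.
have u0 : 0 < u by rewrite exprn_gt0 // ltr_pwDl ?normc_ge0.
exists (m / ((L + 1) * u)) => [|t' t01' tt'].
  by rewrite divr_gt0 // mulr_gt0 // ltr_wpDl.
split=> allneg; last by have := allneg _ rs0; rewrite ltNge ltW.
have [rs srs ft] := factor t'.
have lo : m <= nc (f t').[s0].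
  rewrite ft hornerZ ComplexField.Normc.normcM /m ler_wpM2l ?(ltW cn) //.
  rewrite -srs; apply: normc_prod_ge; first exact: ltW.
  move=> r rin; apply: le_trans (normc_ge_Im _); apply: le_trans (ler_norm _).
  have : Im r < 0 by apply: allneg; rewrite (rootf _ _ _ ft).
  by rewrite raddfB /=; lra.
have hi := fL _ _ s0 t01 t01'; rewrite (eqP rs0) subr0 in hi.
have := le_trans lo hi; rewrite leNgt => /negP; case.
rewrite ltr_pdivlMr ?mulr_gt0 ?ltr_wpDl // in tt'.
by apply: le_lt_trans tt'; rewrite -/u; have := normr_ge0 (t' - t); nra.
Qed.
End Homotopy.
(** * Garding's theorem as a half-plane property *)

Section Stability.
Variables (R : realType) (V : vectType R).
Local Notation C := R[i].
Local Notation iota := (real_complex R).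
Local Notation Im := (@complex.Im R).
Local Notation co v i := (coord (vbasis {:V}) i v).
Implicit Types (p q : polyOn V) (e v x y : V) (t s z : C).

Lemma pencilE q e x :
  pencil q e x =
  mmap (@polyC R \o idfun) (fun i => (- co x i)%:P + co e i *: 'X) q.
Proof.
by apply: eq_mmap => // i; rewrite polyCN addrC -mul_polyC.
Qed.

Lemma horner_pencil_complex q e x z :
  (map_poly iota (pencil q e x)).[z] =
  mmap iota (fun i => z * (co e i)%:C%C - (co x i)%:C%C) q.
Proof.
rewrite -[LHS]/((horner_eval z \o map_poly iota) _) rmorph_mmap.
apply: eq_mmap => [c|i] /=; rewrite /horner_eval ?map_polyC ?hornerC //.
by rewrite rmorphB rmorphM /= map_polyX !map_polyC !hornerE mulrC.
Qed.

Lemma mmap_real q x : mmap iota (fun i => (co x i)%:C%C) q = (evalOn q x)%:C%C.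
Proof. by rewrite /evalOn /meval rmorph_mmap; apply: eq_mmap. Qed.

(** All eigenvalues of [y] are positive, that is, [y] is interior to the
    hyperbolicity cone. *)
Definition posdef p e y := forall tau : R, tau <= 0 -> evalOn p (tau *: e - y) != 0.

Lemma conjc_mul_normsq z : z * conjc z = (complex.Re z ^+ 2 + Im z ^+ 2)%:C%C.
Proof. by rewrite add_Re2_Im2 sqr_normc. Qed.

Lemma Im_realM (k : R) z : Im (k%:C%C * z) = k * Im z.
Proof. by case: z => a b /=; rewrite mul0r addr0. Qed.

(** The logarithmic derivative at [0] is the sum of the [- 1 / r] over the roots
    [r], and each of these has negative imaginary part. *)
Lemma im_logderiv_le0 (P : {poly C}) :
  (forall s, root P s -> Im s < 0) -> Im (P^`().[0] * conjc P.[0]) <= 0.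
Proof.
have [rs ->] := closed_field_poly_normal P; set c := lead_coef P => rsI.
have [->|c0] := eqVneq c 0.
  by rewrite scale0r deriv0 !horner0 mul0r.
have {rsI} rsI r : r \in rs -> Im r < 0.
  by move=> rin; apply: rsI; rewrite rootZ // root_prod_XsubC.
set Q := \prod_(r <- rs) _.
suff QI : Im (Q^`().[0] * conjc Q.[0]) <= 0.
  rewrite derivZ !hornerZ rmorphM /= mulrACA conjc_mul_normsq Im_realM.
  by rewrite mulr_ge0_le0 // addr_ge0 ?sqr_ge0.
rewrite {}/Q; elim: rs rsI => [|r rs IH] rsI.
  by rewrite big_nil derivC horner0 mul0r.
rewrite big_cons; set Q := \prod_(r <- rs) _ in IH *.
have {IH} QI : Im (Q^`().[0] * conjc Q.[0]) <= 0.
  by apply: IH => r' r'in; rewrite rsI // in_cons r'in orbT.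
have rI : Im r < 0 by rewrite rsI ?mem_head.
rewrite derivM derivXsubC mul1r !hornerE rmorphM rmorphN /=.
have -> : (Q.[0] + - r * Q^`().[0]) * (- conjc r * conjc Q.[0]) =
    - ((Q.[0] * conjc Q.[0]) * conjc r)
    + (r * conjc r) * (Q^`().[0] * conjc Q.[0]) by ring.
rewrite raddfD raddfN /= !conjc_mul_normsq !Im_realM.
have -> : Im (conjc r) = - Im r by case: (r).
rewrite mulrN opprK -[leRHS]addr0 lerD // mulr_ge0_le0 ?addr_ge0 ?sqr_ge0 //; exact: ltW.
Qed.

Section Hyperbolic.
Variables (n : nat) (p : polyOn V) (e : V).
Hypothesis p_homog : p \is n.-homog.
Hypothesis p_real : forall x, only_real_zeros (pencil p e x).

Lemma real_zeros_Im x z :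
  mmap iota (fun i => z * (co e i)%:C%C - (co x i)%:C%C) p = 0 -> Im z = 0.
Proof. by rewrite -horner_pencil_complex => /eqP; apply: p_real. Qed.

(** For a fixed [t], move [s |-> p (theta x + t e + s y)] from [theta = 0] to
    [theta = 1].  A real root [s] would make [p] vanish at the sum of [t e] and
    a real vector, with [t] not real, against hyperbolicity; at [theta = 0] the
    roots are the [- t / lambda] with [lambda > 0] an eigenvalue of [y]. *)
Lemma stability x y t s : posdef p e y -> 0 < Im t -> 0 <= Im s ->
  mmap iota (fun i => (co x i)%:C%C + t * (co e i)%:C%C + s * (co y i)%:C%C) p
  != 0.
Proof.
move=> ypos tI.
(* The outer variable of [F] is [s], the inner one is [theta]. *)
pose u i : {poly C} := (co x i)%:C%C *: 'X + (t * (co e i)%:C%C)%:P.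
pose v i : {poly C} := ((co y i)%:C%C)%:P.
pose F := mmap (@polyC {poly C} \o (@polyC C \o iota))
  (fun i => (u i)%:P + v i *: 'X) p.
have [sF Fn] : top_coef n F (mmap (@polyC C \o iota) v p) by apply: top_coef_mmap.
have lcE : mmap (@polyC C \o iota) v p = ((evalOn p y)%:C%C)%:P.
  by rewrite -mmap_real rmorph_mmap; apply: eq_mmap.
have py0 : (evalOn p y)%:C%C != 0 :> C.
  have := ypos 0 (lexx _); rewrite scale0r sub0r.
  apply: contra; rewrite fmorph_eq0 /evalOn /meval => /eqP p0.
  have -> : mmap idfun (fun i => co (- y) i) p = mmap idfun (fun i => -1 * co y i) p.
    by apply: eq_mmap => // i; rewrite linearN mulN1r.
  by rewrite (mmap_homog _ _ _ p_homog) p0 mulr0.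
have fE th s' : (map_poly (horner_eval th%:C%C) F).[s'] =
    mmap iota (fun i => th%:C%C * (co x i)%:C%C + t * (co e i)%:C%C
      + s' * (co y i)%:C%C) p.
  rewrite -[LHS]/((horner_eval s' \o map_poly (horner_eval th%:C%C)) _) rmorph_mmap.
  apply: eq_mmap => [c|i] /=.
    by rewrite map_polyC /= /horner_eval !hornerE.
  rewrite rmorphD /= map_polyZ map_polyX map_polyC /= /u /v /horner_eval !hornerE /=.
  by rewrite [_ * th%:C%C]mulrC [_ * s']mulrC.
have noreal th s' : 0 <= th <= 1 ->
    root (map_poly (horner_eval th%:C%C) F) s' -> Im s' != 0.
  move=> _ rs; apply/eqP => sI0.
  have sE : s' = (complex.Re s')%:C%C by rewrite [LHS]complexE sI0 mulr0 addr0.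
  suff /eqP : Im t = 0 by rewrite gt_eqF.
  apply: (@real_zeros_Im (- (th *: x + complex.Re s' *: y))).
  rewrite -[RHS](eqP rs) fE; apply: eq_mmap => // i.
  rewrite linearN linearD !linearZ /= rmorphN rmorphD !rmorphM /= opprK -sE.
  by ring.
have at0 s' : root (map_poly (horner_eval 0%:C%C) F) s' -> Im s' < 0.
  move=> rs; rewrite ltNge; apply/negP => sI.
  have := eqP rs; rewrite fE => z0.
  have [s0|s0] := eqVneq s' 0.
    suff /eqP : Im t = 0 by rewrite gt_eqF.
    apply: (@real_zeros_Im 0); rewrite -[RHS]z0; apply: eq_mmap => // i.
    by rewrite /= s0 linear0 rmorph0 !mul0r add0r addr0 subr0.
  pose z := - t / s'.
  have zz : mmap iota (fun i => z * (co e i)%:C%C - (co y i)%:C%C) p = 0.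
    rewrite -[RHS](mulr0 ((- s'^-1) ^+ n)) -z0 -(mmap_homog _ _ _ p_homog).
    by apply: eq_mmap => // i; rewrite /z rmorph0; field.
  have zE : z = (complex.Re z)%:C%C.
    by rewrite [LHS]complexE (real_zeros_Im zz) mulr0 addr0.
  have Rz : 0 < complex.Re z.
    rewrite ltNge; apply/negP => /(ypos _) /negP; apply.
    rewrite -(fmorph_eq0 iota) /= -mmap_real -[X in _ == X]zz; apply/eqP.
    by apply: eq_mmap => // i; rewrite linearB linearZ /= rmorphB rmorphM /= -zE.
  have tE : t = - ((complex.Re z)%:C%C * s') by rewrite -zE /z; field.
  by move: tI; rewrite tE raddfN /= Im_realM oppr_gt0 ltNge mulr_ge0 // ltW.
move=> sI; apply/eqP => z0.
suff : Im s < 0 by rewrite ltNge sI.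
have h1 := root_homotopy py0 sF _ noreal at0.
apply: h1; first by rewrite Fn.
rewrite rootE fE -[X in _ == X]z0; apply/eqP; apply: eq_mmap => // i.
by rewrite mul1r.
Qed.

Lemma im_dirD_posdef x y t : posdef p e y -> 0 < Im t ->
  Im ((map_poly iota (pencil (dirD (fun i => co y i) p) e x)).[t]
      * conjc (map_poly iota (pencil p e x)).[t]) <= 0.
Proof.
move=> ypos tI.
pose u i : C := t * (co e i)%:C%C - (co x i)%:C%C.
pose P := mmap (@polyC C \o iota) (fun i => (u i)%:P + iota (co y i) *: 'X) p.
have PE (q : polyOn V) s :
    (mmap (@polyC C \o iota) (fun i => (u i)%:P + iota (co y i) *: 'X) q).[s] =
    mmap iota (fun i => u i + s * (co y i)%:C%C) q.
  rewrite -[LHS]/(horner_eval s _) rmorph_mmap; apply: eq_mmap => [c|i] /=.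
    by rewrite /horner_eval hornerC.
  by rewrite /horner_eval !hornerE mulrC.
have P0 (q : polyOn V) : (map_poly iota (pencil q e x)).[t] =
    (mmap (@polyC C \o iota) (fun i => (u i)%:P + iota (co y i) *: 'X) q).[0].
  by rewrite PE horner_pencil_complex; apply: eq_mmap => // i; rewrite mul0r addr0.
rewrite !P0 -(deriv_mmap iota); apply: im_logderiv_le0 => s; rewrite rootE PE.
apply: contraTT; rewrite -leNgt => sI.
have := @stability (- x) y t s ypos tI sI; congr (_ != _).
by apply: eq_mmap => // i; rewrite linearN rmorphN [- _ + _]addrC.
Qed.

(** Boundary points of the cone are reached as limits of [y + k e], [k > 0]; the
    quantity in question is affine in [k]. *)
Lemma im_dirD_cone x y t :
    (forall tau : R, tau < 0 -> evalOn p (tau *: e - y) != 0) -> 0 < Im t ->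
  Im ((map_poly iota (pencil (dirD (fun i => co y i) p) e x)).[t]
      * conjc (map_poly iota (pencil p e x)).[t]) <= 0.
Proof.
move=> ycone tI.
set G := conjc _.
pose h b := (map_poly iota (pencil (dirD (fun i => co b i) p) e x)).[t].
rewrite -/(h y).
have step (k : R) : 0 < k -> Im (h y * G) + k * Im (h e * G) <= 0.
  move=> k0; have kpos : posdef p e (y + k *: e).
    move=> tau tau0; have := ycone (tau - k); rewrite scalerBl opprD addrCA addrA.
    by rewrite [_ - y]addrC addrA; apply; lra.
  have := @im_dirD_posdef x _ t kpos tI; rewrite -/(h _).
  have -> : h (y + k *: e) = h y + k%:C%C * h e.
    rewrite /h !horner_pencil_complex.
    rewrite -[k%:C%C](mmapC (fun i => t * (co e i)%:C%C - (co x i)%:C%C) iota).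
    rewrite -rmorphM -rmorphD /=; congr mmap; rewrite /dirD mul_mpolyC scaler_sumr.
    rewrite -big_split; apply: eq_bigr => i _ /=.
    by rewrite linearD linearZ /= scalerDl scalerA.
  by rewrite mulrDl raddfD /= -mulrA Im_realM.
have hle : forall a b : R, (forall k, 0 < k -> a + k * b <= 0) -> a <= 0.
  move=> a b ab; rewrite leNgt; apply/negP => a0.
  have := ab (a / (2 * (1 + `|b|))); have b0 := normr_ge0 b.
  have d0 : 0 < 2 * (1 + `|b|) by lra.
  rewrite divr_gt0 // => /(_ isT); apply/negP; rewrite -ltNge.
  have : - `|b| <= b by have := ler_norm (- b); rewrite normrN; lra.
  set k := a / _ => bb; have k0 : 0 < k by rewrite divr_gt0.
  have aE : a = k * (2 * (1 + `|b|)) by rewrite /k divfK // gt_eqF.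
  by rewrite {1}aE; nra.
exact: hle step.
Qed.
End Hyperbolic.
End Stability.
(** * Partial fractions with nonnegative residues *)

Section PartialFractions.
Variables (R : realType) (n : nat) (lam : 'I_n -> R) (c : R).
Local Notation C := R[i].
Local Notation iota := (real_complex R).
Local Notation nc := (@ComplexField.Normc.normc R).
Local Notation Im := (@complex.Im R).
Implicit Types (h : {poly R}) (mu : R) (z : C).
Hypothesis c_neq0 : c != 0.

(** Here [fullpoly] is a split polynomial listed with repeated roots [lam].
    The partial fraction expansion of [h / fullpoly] has one term for each
    index, so the residue at a root of multiplicity [m] is shared equally by
    the [m] indices of this root.  It is written with a polynomial quotient
    instead of a limit, which makes it linear in [h]. *)
Definition mult mu := #|[pred r | lam r == mu]|.
Definition cofact mu : {poly R} := c *: \prod_(r | lam r != mu) ('X - (lam r)%:P).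
Definition fullpoly : {poly R} := c *: \prod_r ('X - (lam r)%:P).
Definition omit r : {poly R} := c *: \prod_(r' | r' != r) ('X - (lam r')%:P).
Definition residue r h : R :=
  (h %/ ('X - (lam r)%:P) ^+ (mult (lam r)).-1).[lam r] /
  ((mult (lam r))%:R * (cofact (lam r)).[lam r]).

Lemma mult_gt0 r : (0 < mult (lam r))%N.
Proof. by apply/card_gt0P; exists r; rewrite inE. Qed.

Lemma fullpoly_cofact mu : fullpoly = ('X - mu%:P) ^+ mult mu * cofact mu.
Proof.
rewrite /fullpoly /cofact -scalerAr; congr (_ *: _).
rewrite (bigID (fun r => lam r == mu)) /=; congr (_ * _).
rewrite -prodr_const; apply: eq_bigr => r /eqP ->; by [].
Qed.

Lemma cofact_neq0 mu : (cofact mu).[mu] != 0.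
Proof.
rewrite /cofact hornerZ mulf_neq0 // horner_prod; apply/prodf_neq0 => r rmu.
by rewrite hornerXsubC subr_eq0 eq_sym.
Qed.

Lemma omit_cofact r :
  omit r = ('X - (lam r)%:P) ^+ (mult (lam r)).-1 * cofact (lam r).
Proof.
have X0 : 'X - (lam r)%:P != 0 by rewrite polyXsubC_eq0.
apply: (mulfI X0).
rewrite mulrA -exprS prednK ?mult_gt0 // -fullpoly_cofact /omit /fullpoly.
by rewrite -scalerAr [in RHS](bigD1 r).
Qed.

Lemma omit_dvd r mu : lam r != mu -> ('X - mu%:P) ^+ mult mu %| omit r.
Proof.
move=> rmu; rewrite /omit dvdpZr //.
rewrite (bigID (fun r' => lam r' == mu)) /=; apply: dvdp_mulr.
rewrite -prodr_const (eq_bigl (fun r' => lam r' == mu)) => [|r'].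
  rewrite [X in _ %| X](eq_bigr (fun=> 'X - mu%:P)) ?dvdpp // => r' /eqP ->; by [].
by case: eqP => //= ->; rewrite (negbTE rmu).
Qed.

Lemma residueD r h1 h2 : residue r (h1 + h2) = residue r h1 + residue r h2.
Proof. by rewrite /residue divpD hornerD mulrDl. Qed.

Lemma residue_deriv r : residue r fullpoly^`() = 1.
Proof.
rewrite /residue; set mu := lam r; have m0 := mult_gt0 r; rewrite -/mu in m0 *.
have -> : fullpoly^`() = (cofact mu *+ mult mu + ('X - mu%:P) * (cofact mu)^`())
    * ('X - mu%:P) ^+ (mult mu).-1.
  rewrite (fullpoly_cofact mu) derivM deriv_exp derivXsubC mul1r.
  rewrite -[in X in _ + X](prednK m0) exprS.
  have gen (A B B' Y : {poly R}) k :
      A *+ k * B + Y * A * B' = (B *+ k + Y * B') * A.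
    by rewrite mulrDl !mulrnAl; congr (_ *+ _ + _); ring.
  exact: gen.
rewrite mulpK ?expf_neq0 ?polyXsubC_eq0 // hornerD hornerM hornerXsubC subrr mul0r.
by rewrite addr0 hornerMn mulr_natl divff // mulrn_eq0 negb_or -lt0n m0 cofact_neq0.
Qed.

Lemma prod_XsubC_dvdp (s : seq R) h :
  h != 0 -> (forall a, (count_mem a s <= mup a h)%N) ->
  \prod_(a <- s) ('X - a%:P) %| h.
Proof.
elim: s h => [|a s IH] h h0 cs; first by rewrite big_nil dvd1p.
have : 'X - a%:P %| h by rewrite XsubC_dvd // (leq_trans _ (cs a)) //= eqxx.
move=> /dvdpP [h' hE]; rewrite big_cons hE mulrC.
have h'0 : h' != 0 by apply: contraNneq h0 => z; rewrite hE z mul0r.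
rewrite dvdp_mul2r ?polyXsubC_eq0 //.
apply: IH => // b; have := cs b.
rewrite hE mupM ?polyXsubC_eq0 // -['X - _]expr1 mup_XsubCX /= addnC.
by case: eqP => _ /=; rewrite ?leq_add2r ?addn0.
Qed.

(** The difference of the two sides vanishes at each root of [fullpoly] to the
    full multiplicity, but its degree is smaller. *)
Lemma partial_fraction h : (size h <= n)%N ->
  (forall r, ('X - (lam r)%:P) ^+ (mult (lam r)).-1 %| h) ->
  h = \sum_r residue r h *: omit r.
Proof.
move=> sh hdvd; apply/eqP; rewrite -subr_eq0; set D := _ - _.
apply/negPn/negP => D0.
have sD : (size D <= n)%N.
  rewrite (leq_trans (size_polyD _ _)) // geq_max sh size_polyN.
  apply: (leq_trans (size_sum _ _ _)); apply/bigmax_leqP => r _.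
  apply: (leq_trans (size_scale_leq _ _)).
  rewrite /omit size_scale // size_prod => [|r' _]; last by rewrite polyXsubC_eq0.
  rewrite (eq_bigr (fun=> 2%N)) => [|r' _]; last by rewrite size_XsubC.
  rewrite sum_nat_const (eq_card (B := predC1 r)) // cardC1 card_ord.
  by have := ltn_ord r; lia.
suff : fullpoly %| D.
  have sF : size fullpoly = n.+1.
    rewrite /fullpoly size_scale // size_prod => [|r' _]; last by rewrite polyXsubC_eq0.
    rewrite (eq_bigr (fun=> 2%N)) => [|r' _]; last by rewrite size_XsubC.
    by rewrite sum_nat_const card_ord; lia.
  by move=> /(dvdp_leq D0); rewrite sF leqNgt ltnS sD.
rewrite /fullpoly dvdpZl // -big_enum /= -(big_map lam xpredT (fun a => 'X - a%:P)).
apply: prod_XsubC_dvdp => // mu.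
have -> : count_mem mu (map lam (enum 'I_n)) = mult mu.
  rewrite count_map -size_filter /mult cardE [in RHS]/enum_mem -enumT.
  by congr size; apply: eq_filter.
rewrite mup_geq //.
have [m0|] := posnP (mult mu); first by rewrite m0 expr0 dvd1p.
move=> m0; have /card_gt0P [r0] := m0; rewrite inE => /eqP r0mu.
have /dvdpP [h2 hE] := hdvd r0; rewrite r0mu in hE.
have resE r : lam r = mu -> residue r h *: omit r =
    (h2.[mu] / (mult mu)%:R / (cofact mu).[mu]) *:
      (('X - mu%:P) ^+ (mult mu).-1 * cofact mu).
  move=> rmu; rewrite omit_cofact /residue rmu hE.
  by rewrite mulpK ?expf_neq0 ?polyXsubC_eq0 // invfM mulrA.
rewrite /D (bigID (fun r => lam r == mu)) /= opprD addrA.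
apply: dvdp_sub; last first.
  apply: (big_ind (fun q => _ %| q)) => [|q1 q2|r rmu]; first exact: dvdp0.
    exact: dvdp_add.
  by rewrite -mul_polyC dvdp_mull ?omit_dvd.
rewrite (eq_bigr _ (fun r rmu => resE r (eqP rmu))) sumr_const.
rewrite -/(mult mu) {1}hE [h2 * _]mulrC -scaler_nat scalerA scalerAr -mulrBr.
rewrite -[in X in X %| _](prednK m0) exprSr dvdp_mul2l ?expf_neq0 ?polyXsubC_eq0 //.
have mn0 : (mult mu)%:R != 0 :> R by rewrite pnatr_eq0 -lt0n.
rewrite dvdp_XsubCl; have := cofact_neq0 mu; move: (cofact mu) => G G0.
by rewrite rootE hornerD hornerN hornerZ; apply/eqP; field; apply/andP.
Qed.

Lemma Im_poly_limit (Q : {poly C}) :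
  (forall eps : R, 0 < eps -> Im Q.[eps%:C%C] <= 0) -> Im Q.[0] <= 0.
Proof.
move=> Qneg; have [L L0 QL] := poly_lipschitz_unit Q.
rewrite leNgt; apply/negP => Q0.
pose eps := Num.min 1 (Im Q.[0] / (2 * (L + 1))).
have eps0 : 0 < eps by rewrite lt_min ltr01 divr_gt0 // mulr_gt0 // ltr_wpDl.
have eps1 : eps <= 1 by rewrite ge_min lexx.
have epsQ : eps * (2 * (L + 1)) <= Im Q.[0].
  by rewrite -ler_pdivlMr ?ge_min ?lexx ?orbT // mulr_gt0 // ltr_wpDl.
have := QL 0 eps%:C%C; rewrite ComplexField.Normc.normc0 normc_real ltW //.
rewrite gtr0_norm // => /(_ isT eps1); rewrite sub0r normcN normc_real gtr0_norm //.
have := normc_ge_Im (Q.[0] - Q.[eps%:C%C]); rewrite raddfB /=.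
have := ler_norm (Im Q.[0] - Im Q.[eps%:C%C]).
by have := Qneg _ eps0; nra.
Qed.

Lemma conjc_horner_real h z : conjc (map_poly iota h).[z] = (map_poly iota h).[conjc z].
Proof.
rewrite -[LHS]horner_map; congr _.[_]; rewrite -map_poly_comp.
by apply: eq_map_poly => a; rewrite /= oppr0.
Qed.

(** For [k > 1] the root of minimal argument lies in the upper half-plane; it is
    not real since its [k]-th power is not. *)
Lemma exists_upper_root k (a : C) : (1 < k)%N -> Im a != 0 ->
  exists2 w : C, 0 < Im w & w ^+ k = a.
Proof.
move=> k1 aI; exists (k.-root a); last by rewrite rootCK // ltnW.
have wk : k.-root a ^+ k = a by rewrite rootCK // ltnW.
have : 0 <= Im (k.-root a) by rewrite -ler0c complexIm Im_rootC_ge0.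
rewrite le_eqVlt => /orP[/eqP w0|//]; case/eqP: aI.
rewrite -wk [k.-root a]complexE -w0 mulr0 addr0 -rmorphXn; by [].
Qed.

Section Nonneg.
Variable h : {poly R}.
Hypothesis h_upper : forall z, 0 < Im z ->
  Im ((map_poly iota h).[z] * conjc (map_poly iota fullpoly).[z]) <= 0.

(** Approach the root [mu] along the ray of direction [w]: after division by a
    positive power of the distance, the hypothesis passes to the limit and
    keeps only the leading terms of [h] and [fullpoly]. *)
Lemma leading_sign mu k h1 w : h = h1 * ('X - mu%:P) ^+ k -> 0 < Im w ->
  Im (w ^+ k * conjc w ^+ mult mu) * (h1.[mu] * (cofact mu).[mu]) <= 0.
Proof.
move=> hE wI; set m := mult mu; set kap := w ^+ k * _.
pose at_line (q : {poly R}) (u : C) : {poly C} :=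
  (map_poly iota q) \Po (mu%:C%C%:P + u *: 'X).
have atE q u z : (at_line q u).[z] = (map_poly iota q).[mu%:C%C + u * z].
  by rewrite horner_comp !hornerE.
pose Q := kap%:P * (at_line h1 w * at_line (cofact mu) (conjc w)).
have Q0 : Q.[0] = kap * (h1.[mu] * (cofact mu).[mu])%:C%C.
  by rewrite !hornerM hornerC !atE !mulr0 addr0 rmorphM -!horner_map.
rewrite mulrC -Im_realM mulrC -Q0; apply: Im_poly_limit => eps eps0.
have zI : 0 < Im (mu%:C%C + w * eps%:C%C).
  by rewrite raddfD /= mulrC Im_realM add0r mulr_gt0.
have conjE : conjc (mu%:C%C + w * eps%:C%C) = mu%:C%C + conjc w * eps%:C%C.
  by rewrite rmorphD rmorphM; congr (_ + _ * _); apply: conjc_real.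
have ev (q : {poly R}) k' z :
    (map_poly iota (q * ('X - mu%:P) ^+ k')).[mu%:C%C + z] =
    (map_poly iota q).[mu%:C%C + z] * z ^+ k'.
  rewrite rmorphM rmorphXn rmorphB /= map_polyX map_polyC hornerM horner_exp.
  by rewrite hornerXsubC [_ + z]addrC addrK.
have := h_upper zI; rewrite conjc_horner_real conjE (fullpoly_cofact mu) hE.
rewrite [_ ^+ mult mu * _]mulrC !ev -/m.
set A := _.[_]; set B := _.[_].
have -> : A * (w * eps%:C%C) ^+ k * (B * (conjc w * eps%:C%C) ^+ m) =
    (eps ^+ (k + m))%:C%C * Q.[eps%:C%C].
  rewrite exprD rmorphM !rmorphXn !hornerM hornerC !atE -/A -/B /kap !exprMn.
  have gen (a b a' b' x y : C) :
      a * (x * a') * (b * (y * b')) = a' * b' * (x * y * (a * b)) by ring.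
  exact: gen.
by rewrite Im_realM pmulr_rle0 // exprn_gt0.
Qed.

(** If [h] vanishes at [mu] to an order smaller by at least 2 than [fullpoly],
    then directions [w] with [w ^+ (m - k)] equal to [i] and to [- i] both lie
    in the upper half-plane and give opposite strict signs.  If the orders
    differ by 1, the direction [i] gives the sign of the residue. *)
Lemma residue_dvd_ge0 r :
  ('X - (lam r)%:P) ^+ (mult (lam r)).-1 %| h /\ 0 <= residue r h.
Proof.
set mu := lam r; set m := mult mu; have m0 : (0 < m)%N by apply: mult_gt0.
have [h0|h0] := eqVneq h 0.
  by rewrite h0 dvdp0 /residue div0p horner0 mul0r.
have lead_i : forall k h1 (a : C), h = h1 * ('X - mu%:P) ^+ k -> (k < m)%N ->
    (exists2 w : C, 0 < Im w & w ^+ (m - k) = a) ->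
    0 <= Im a * (h1.[mu] * (cofact mu).[mu]).
  move=> k h1 a hE km [w wI wa].
  have wE : w ^+ k * conjc w ^+ m = (w * conjc w) ^+ k * conjc (w ^+ (m - k)).
    by rewrite exprMn rmorphXn -mulrA -exprD subnKC // ltnW.
  have := leading_sign hE wI; rewrite -/m wE wa conjc_mul_normsq -rmorphXn Im_realM.
  have -> : Im (conjc a) = - Im a by case: (a).
  rewrite mulrN mulNr oppr_le0 -mulrA pmulr_rge0 // exprn_gt0 //.
  by rewrite ltr_wpDl ?sqr_ge0 // exprn_gt0.
have [k hk] : exists k, k = mup mu h by exists (mup mu h).
have /dvdpP [h1 hE] : ('X - mu%:P) ^+ k %| h by rewrite -mup_geq // hk.
have h1mu : h1.[mu] != 0.
  apply/negP => /factor_theorem [h2 h1E].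
  have : (k.+1 <= mup mu h)%N by rewrite mup_geq // hE h1E -mulrA -exprS dvdp_mull.
  by rewrite hk ltnn.
have [km|mk] := ltnP k m; last first.
  have hE' : h = h1 * ('X - mu%:P) ^+ (k - m.-1) * ('X - mu%:P) ^+ m.-1.
    by rewrite -mulrA -exprD subnK // (leq_trans (leq_pred m)).
  split; first by rewrite hE' dvdp_mull.
  rewrite /residue -/mu -/m hE' mulpK ?expf_neq0 ?polyXsubC_eq0 //.
  rewrite hornerM horner_exp hornerXsubC subrr expr0n subn_eq0 leqNgt.
  by rewrite (leq_trans _ mk) ?prednK // mulr0 mul0r.
have prod0 : h1.[mu] * (cofact mu).[mu] != 0 by rewrite mulf_neq0 ?cofact_neq0.
have [mk1|mk1] := ltnP 1 (m - k).
  have up := exists_upper_root mk1.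
  have := lead_i _ _ _ hE km (up 'i%C _); rewrite /= mul1r oner_eq0 => /(_ isT) ge.
  have := lead_i _ _ _ hE km (up (- 'i%C) _).
  rewrite /= oppr_eq0 oner_eq0 mulN1r oppr_ge0 => /(_ isT) le.
  by case/eqP: prod0; apply/eqP; rewrite eq_le le ge.
have km1 : k = m.-1 by lia.
split; first by rewrite -km1 hE dvdp_mull.
have sgn : 0 <= h1.[mu] * (cofact mu).[mu].
  have := lead_i _ _ 'i%C hE km; rewrite /= mul1r; apply.
  by exists 'i%C; rewrite ?ltr01 // (_ : m - k = 1)%N //; lia.
rewrite /residue -/mu -/m -km1 hE mulpK ?expf_neq0 ?polyXsubC_eq0 //.
have c2 : 0 < (cofact mu).[mu] ^+ 2.
  by rewrite lt_neqAle sqr_ge0 eq_sym sqrf_eq0 cofact_neq0.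
have -> : h1.[mu] / (m%:R * (cofact mu).[mu]) =
    h1.[mu] * (cofact mu).[mu] / (m%:R * (cofact mu).[mu] ^+ 2).
  have cf0 := cofact_neq0 mu; move: {prod0 sgn c2} _.[mu] cf0 => d d0.
  by field; rewrite d0 pnatr_eq0 -lt0n m0.
by rewrite divr_ge0 // mulr_ge0 ?ler0n ?ltW.
Qed.
End Nonneg.
End PartialFractions.
(** * Doubly stochastic matrices *)

Section DoublyStochastic.
Variables (R : realType) (n : nat).
Implicit Types (D G : 'M[R]_n) (u v : 'I_n -> R).

Lemma ds_matrix_trmx D : ds_matrix D -> ds_matrix D^T.
Proof.
by case=> D0 Dr Dc; split=> [i j|i|j]; rewrite ?mxE //;
  [rewrite -[RHS](Dc i) | rewrite -[RHS](Dr j)]; apply: eq_bigr => k _; rewrite mxE.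
Qed.

Lemma ds_matrix_mul D G : ds_matrix D -> ds_matrix G -> ds_matrix (D *m G).
Proof.
case=> D0 Dr Dc [G0 Gr Gc]; split=> [i j|i|j].
- by rewrite mxE; apply: sumr_ge0 => k _; apply: mulr_ge0.
- under eq_bigr do rewrite mxE.
  rewrite exchange_big -[RHS](Dr i); apply: eq_bigr => k _ /=.
  by rewrite -mulr_sumr Gr mulr1.
under eq_bigr do rewrite mxE.
rewrite exchange_big -[RHS](Gc j); apply: eq_bigr => k _ /=.
by rewrite -mulr_suml Dc mul1r.
Qed.

(** The defect [\sum_r u r ^+ 2 - \sum_j v j ^+ 2] is the sum over [j] of the
    variances of [u] under the probability vectors [G j].  If it vanishes, then
    [u r = v j] as soon as [G j r != 0]. *)
Lemma ds_isometry_transpose G u v : ds_matrix G ->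
  (forall j, v j = \sum_r G j r * u r) ->
  \sum_j v j ^+ 2 = \sum_r u r ^+ 2 ->
  forall r, u r = \sum_j G j r * v j.
Proof.
case=> G0 Gr Gc vE normE r.
have var0 : \sum_j \sum_s G j s * (u s - v j) ^+ 2 = 0.
  have -> : \sum_j \sum_s G j s * (u s - v j) ^+ 2 =
      \sum_j \sum_s G j s * u s ^+ 2 - \sum_j v j ^+ 2.
    rewrite -sumrB; apply: eq_bigr => j _.
    have -> : v j ^+ 2 = \sum_s G j s * (2 * u s * v j - v j ^+ 2).
      under eq_bigr do rewrite mulrBr.
      rewrite sumrB -mulr_suml Gr mul1r.
      under eq_bigr do rewrite mulrA mulrCA -mulrA.
      by rewrite -mulr_sumr -[in RHS]mulr_suml -vE; ring.
    by rewrite -sumrB; apply: eq_bigr => s _; ring.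
  rewrite exchange_big normE -sumrB big1 // => s _ /=.
  by rewrite -mulr_suml Gc mul1r subrr.
rewrite -[LHS]mul1r -(Gc r) mulr_suml; apply: eq_bigr => j _.
have t0 : G j r * (u r - v j) ^+ 2 = 0.
  have ge j' s : 0 <= G j' s * (u s - v j') ^+ 2 by rewrite mulr_ge0 ?sqr_ge0.
  have row0 := psumr_eq0P (fun j' _ => sumr_ge0 _ (fun s _ => ge j' s)) var0.
  exact: (psumr_eq0P (fun s _ => ge j s) (row0 j isT)).
move/eqP: t0; rewrite mulf_eq0 sqrf_eq0 => /orP[/eqP ->|]; first by rewrite !mul0r.
by rewrite subr_eq0 => /eqP ->.
Qed.

Lemma dec_rearr_sorted (l : 'rV[R]_n) (i : 'I_n) :
  (forall j k : 'I_n, (j <= k)%N -> l 0 k <= l 0 j) -> (dec_rearr l)`_i = l 0 i.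
Proof.
move=> dec; rewrite /dec_rearr sorted_sort.
- rewrite (nth_map i) ?size_enum_ord //; by rewrite nth_ord_enum.
- by move=> x y z /= yx zy; apply: le_trans zy yx.
apply/(sortedP 0) => k; rewrite size_map size_enum_ord => kn.
rewrite !(nth_map i) -?enumT ?size_enum_ord // ?(ltnW kn) //.
by apply: dec; rewrite !nth_enum_ord // ltnW.
Qed.

(** The sum of the first [k] entries of [m] is [\sum_j g j * l j] with
    [0 <= g j <= 1] and [\sum_j g j = k]; comparing each [l j] with the entry
    [s] of rank [k] shows that it is at most the sum of the first [k] entries
    of [l]. *)
Lemma ds_image_majorized D (l m : 'rV[R]_n) : ds_matrix D ->
  (forall j k : 'I_n, (j <= k)%N -> l 0 k <= l 0 j) ->
  (forall j k : 'I_n, (j <= k)%N -> m 0 k <= m 0 j) ->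
  (forall i, m 0 i = \sum_j D i j * l 0 j) ->
  majorized m l.
Proof.
case=> D0 Dr Dc ldec mdec mE.
have sumE (x : 'rV[R]_n) k : (forall i j : 'I_n, (i <= j)%N -> x 0 j <= x 0 i) ->
    (k <= n)%N ->
    \sum_(0 <= i < k) (dec_rearr x)`_i = \sum_(i < n | (i < k)%N) x 0 i.
  move=> xdec kn; rewrite big_mkord (big_ord_widen n (fun i => (dec_rearr x)`_i)) //.
  by apply: eq_bigr => i _; apply: dec_rearr_sorted.
split=> [k /andP[k1 kn]|]; last first.
  rewrite !sumE // !(eq_bigl predT) => [|i|i]; rewrite ?ltn_ord //.
  under eq_bigr do rewrite mE.
  rewrite exchange_big; apply: eq_bigr => j _ /=.
  by rewrite -mulr_suml Dc mul1r.
rewrite !sumE //.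
pose g j := \sum_(i < n | (i < k)%N) D i j.
have mg : \sum_(i < n | (i < k)%N) m 0 i = \sum_j g j * l 0 j.
  under eq_bigr do rewrite mE.
  by rewrite exchange_big; apply: eq_bigr => j _; rewrite /g mulr_suml.
have lt : (k.-1 < n)%N by rewrite prednK.
pose s := l 0 (Ordinal lt).
have gs : \sum_j (g j - (j < k)%:R) = 0.
  rewrite sumrB /g exchange_big /=.
  rewrite (eq_bigr (fun=> 1)) => [|i _]; last exact: Dr.
  by rewrite [X in X - _]big_mkcond /= -sumrB big1 // => i _; case: ifP; rewrite subrr.
rewrite mg [leRHS]big_mkcond /= -subr_ge0 -sumrB.
have -> : \sum_(j < n) ((if (j < k)%N then l 0 j else 0) - g j * l 0 j) =
    \sum_(j < n) ((if (j < k)%N then l 0 j else 0) - g j * l 0 j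
                  + s * (g j - (j < k)%:R)).
  by rewrite [RHS]big_split /= -mulr_sumr gs mulr0 addr0.
apply: sumr_ge0 => j _.
have g0 : 0 <= g j by apply: sumr_ge0.
have g1 : g j <= 1.
  rewrite -(Dc j) [leRHS](bigID (fun i : 'I_n => (i < k)%N)) /= lerDl.
  exact: sumr_ge0.
case: ltnP => jk /=; rewrite -subr_ge0.
  have sl : s <= l 0 j by apply: ldec; rewrite /= -ltnS prednK.
  rewrite (_ : _ - _ = (1 - g j) * (l 0 j - s)); last by ring.
  by rewrite mulr_ge0 // subr_ge0.
have ls : l 0 j <= s by apply: ldec; rewrite /= (leq_trans (leq_pred k)).
rewrite (_ : _ - _ = g j * (s - l 0 j)); last by ring.
by rewrite mulr_ge0 // subr_ge0.
Qed.
End DoublyStochastic.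

(** * The trace, the inner product and the weights *)

Lemma horner_eq_neq0 (R : realType) (P Q : {poly R}) :
  (forall t, t != 0 -> P.[t] = Q.[t]) -> P = Q.
Proof.
move=> PQ; apply/eqP; rewrite -subr_eq0; apply/negPn/negP => D0.
have := max_poly_roots D0 (rs := [seq k.+1%:R | k <- iota 0 (size (P - Q))]).
rewrite size_map size_iota ltnn => /(_ _ _)/negP; apply=> //.
  apply/allP => _ /mapP [k _ ->]; rewrite rootE hornerD hornerN PQ ?subrr //.
  by rewrite pnatr_eq0.
by rewrite map_inj_uniq ?iota_uniq // => i j /eqP; rewrite eqr_nat => /eqP [].
Qed.

(** The first two power sums of [l] can be read off at [0] from the reciprocal
    polynomial. *)
Lemma reciprocal_prod_jet (R : realType) (I : finType) (P : pred I) (l : I -> R) :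
  let W : {poly R} := \prod_(i | P i) (1 - l i *: 'X) in
  [/\ W.[0] = 1, W^`().[0] = - \sum_(i | P i) l i
    & W^`()^`().[0] = (\sum_(i | P i) l i) ^+ 2 - \sum_(i | P i) l i ^+ 2].
Proof.
have d1 : (1 : {poly R})^`() = 0 by rewrite -polyC1 derivC.
elim/big_rec3: _ => [|i s2 s1 W _ [W0 W1 W2]] F.
  by rewrite /F d1 deriv0 !hornerE /=; split => //; ring.
rewrite {}/F.
have dF : (1 - l i *: 'X : {poly R})^`() = - (l i)%:P.
  by rewrite derivB d1 derivZ derivX sub0r alg_polyC.
rewrite derivM dF derivD !derivM dF derivN derivC.
by rewrite !hornerE W0 W1 W2; split; rewrite /=; ring.
Qed.
Section HyperbolicSystem.
Variables (R : realType) (V : vectType R) (n : nat) (p : polyOn V) (e : V).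
Hypotheses (n_gt0 : (0 < n)%N) (hyp : hyperbolic_system n p e).
Local Notation co v := (fun i => coord (vbasis {:V}) i v).
Implicit Types (q : polyOn V) (b v x y : V).

Local Notation c := (evalOn p e).
Local Notation lam x := (lambda n p e x 0).
Local Notation der b q := (dirD (co b) q).

Let p_homog : p \is n.-homog. Proof. by case: hyp. Qed.
Let c_neq0 : c != 0. Proof. by case: hyp. Qed.
Let p_real x : only_real_zeros (pencil p e x). Proof. by case: hyp. Qed.

Lemma pencil_top k q x : q \is k.-homog -> top_coef k (pencil q e x) (evalOn q e).
Proof. by move=> qh; rewrite pencilE; apply: top_coef_mmap. Qed.

Lemma real_roots_pencil x :
  size (real_roots (pencil p e x)) = n /\
  pencil p e x = c *: \prod_(a <- real_roots (pencil p e x)) ('X - a%:P).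
Proof.
have [sz cf] := pencil_top x p_homog.
have szE : size (pencil p e x) = n.+1.
  apply/eqP; rewrite eqn_leq sz ltnNge.
  apply: contra c_neq0 => /leq_sizeP/(_ n (leqnn _)).
  by rewrite cf => ->.
have p0 : pencil p e x != 0 by rewrite -size_poly_eq0 szE.
have lc : lead_coef (pencil p e x) = c by rewrite lead_coefE szE.
have := real_roots_factor p0 (@p_real x); rewrite lc => fE; split=> //.
by have := szE; rewrite {1}fE size_scale // size_prod_XsubC => -[].
Qed.

Lemma pencil_factor x : pencil p e x = fullpoly (lam x) c.
Proof.
have [sz {1}->] := real_roots_pencil x; rewrite /fullpoly; congr (_ *: _).
rewrite (big_nth 0) sz big_mkord; apply: eq_bigr => r _.
by rewrite mxE.
Qed.

Lemma lambda_dec x (j k : 'I_n) : (j <= k)%N -> lam x k <= lam x j.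
Proof.
move=> jk; rewrite !mxE.
have [sz _] := real_roots_pencil x.
have ge_tr : transitive (>=%R : rel R) by move=> u v w vu wv; apply: le_trans wv vu.
have ge_re : reflexive (>=%R : rel R) by move=> u; apply: lexx.
by apply: (sorted_leq_nth ge_tr ge_re 0 (real_roots_sorted _));
  rewrite ?inE ?sz ?ltn_ord.
Qed.

Lemma evalOn_factor x (tau : R) :
  evalOn p (tau *: e - x) = c * \prod_r (tau - lam x r).
Proof.
rewrite -hornerPencil pencil_factor hornerZ horner_prod; congr (_ * _).
by apply: eq_bigr => r _; rewrite hornerXsubC.
Qed.

Lemma derD x y q : der (x + y) q = der x q + der y q.
Proof.
rewrite /dirD -big_split; apply: eq_bigr => i _ /=.
by rewrite linearD scalerDl.
Qed.

Lemma derZ (k : R) x q : der (k *: x) q = k *: der x q.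
Proof.
rewrite /dirD scaler_sumr; apply: eq_bigr => i _ /=.
by rewrite linearZ scalerA.
Qed.

Lemma der_sum (I : finType) (a : I -> V) q : der (\sum_j a j) q = \sum_j der (a j) q.
Proof.
have der0 : der 0 q = 0 by have := derZ 0 0 q; rewrite !scale0r.
by elim/big_rec2: _ => // j q' x _ <-; rewrite derD.
Qed.

Lemma evalOnD q1 q2 x : evalOn (q1 + q2) x = evalOn q1 x + evalOn q2 x.
Proof. by rewrite /evalOn mevalD. Qed.

Lemma evalOnZ (k : R) q x : evalOn (k *: q) x = k * evalOn q x.
Proof. by rewrite /evalOn mevalZ. Qed.

(** The polynomial [t |-> q (e - t x)].  For homogeneous [q] it is the
    reciprocal of the pencil; its derivatives at [0] are directional
    derivatives of [q] at [e], hence polynomial in [x]. *)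
Definition linpoly q x : {poly R} :=
  mmap (@polyC R \o idfun) (fun i => (coord (vbasis {:V}) i e)%:P
    + idfun (coord (vbasis {:V}) i (- x)) *: 'X) q.

Lemma horner_linpoly q x t : (linpoly q x).[t] = evalOn q (e - t *: x).
Proof.
rewrite /linpoly -[LHS]/(horner_eval t _) rmorph_mmap; apply: eq_mmap => [a|i] /=.
  by rewrite /horner_eval hornerC.
by rewrite /horner_eval !hornerE linearB linearN linearZ /= mulrC mulrN.
Qed.

Lemma deriv_linpoly q x : (linpoly q x)^`() = - linpoly (der x q) x.
Proof.
rewrite /linpoly (deriv_mmap idfun (fun i => coord (vbasis {:V}) i e)).
by rewrite -rmorphN; congr mmap; rewrite -[- x]scaleN1r derZ scaleN1r.
Qed.

Lemma linpoly0 q x : (linpoly q x).[0] = evalOn q e.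
Proof. by rewrite horner_linpoly scale0r subr0. Qed.

Lemma horner_linpoly_pencil k q x t : q \is k.-homog -> t != 0 ->
  (linpoly q x).[t] = t ^+ k * (pencil q e x).[t^-1].
Proof.
move=> qh t0; rewrite horner_linpoly hornerPencil /evalOn /meval.
rewrite -(mmap_homog _ _ _ qh); apply: eq_mmap => // i.
by rewrite !linearB !linearZ /= mulrBr mulVKf.
Qed.

Lemma horner_reciprocal (P : pred 'I_n) x t : t != 0 ->
  (\prod_(r | P r) (1 - lam x r *: 'X)).[t] =
  t ^+ #|P| * (\prod_(r | P r) ('X - (lam x r)%:P)).[t^-1].
Proof.
move=> t0; rewrite !horner_prod -prodr_const -big_split; apply: eq_bigr => r _ /=.
by rewrite !hornerE mulrBr divff // mulrC.
Qed.

Lemma linpoly_factor x : linpoly p x = c *: \prod_r (1 - lam x r *: 'X).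
Proof.
apply: horner_eq_neq0 => t t0.
rewrite (horner_linpoly_pencil _ p_homog) // pencil_factor !hornerZ.
by rewrite horner_reciprocal // cardT size_enum_ord mulrCA.
Qed.

Definition trace x : R := c^-1 * evalOn (der x p) e.

Lemma trace_sum x : trace x = \sum_r lam x r.
Proof.
have [_ W1 _] := reciprocal_prod_jet xpredT (lam x).
have := congr1 (fun P : {poly R} => P^`().[0]) (linpoly_factor x).
rewrite /= deriv_linpoly hornerN linpoly0 derivZ hornerZ W1 mulrN /trace.
by move=> /oppr_inj ->; rewrite mulKf.
Qed.

Definition bform x y : R := trace x * trace y - c^-1 * evalOn (der x (der y p)) e.

(** With [s1] and [s2] the first two power sums of the eigenvalues, the second
    derivative of [linpoly p x] at [0] is [c * (s1 ^+ 2 - s2)].  So [s2] is a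
    quadratic form in [x], which makes the semi-inner product bilinear by
    polarization. *)
Lemma sqnorm_bform x : sqnorm (lambda n p e x) = bform x x.
Proof.
have [_ _ W2] := reciprocal_prod_jet xpredT (lam x).
have := congr1 (fun P : {poly R} => P^`()^`().[0]) (linpoly_factor x).
rewrite /= deriv_linpoly derivN deriv_linpoly opprK linpoly0 !derivZ hornerZ W2.
rewrite /bform => ->; rewrite mulKf // trace_sum /sqnorm; ring.
Qed.

Lemma traceD x y : trace (x + y) = trace x + trace y.
Proof. by rewrite /trace derD evalOnD mulrDr. Qed.

Lemma traceZ k x : trace (k *: x) = k * trace x.
Proof. by rewrite /trace derZ evalOnZ mulrCA. Qed.

Lemma bformC x y : bform x y = bform y x.
Proof. by rewrite /bform dirD_comm mulrC. Qed.

Lemma bformDl x y z : bform (x + y) z = bform x z + bform y z.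
Proof. by rewrite /bform traceD derD evalOnD; ring. Qed.

Lemma bformZl k x z : bform (k *: x) z = k * bform x z.
Proof. by rewrite /bform traceZ derZ evalOnZ; ring. Qed.

Lemma sip_bform x y : sip n p e x y = bform x y.
Proof.
rewrite /sip !sqnorm_bform -[- y]scaleN1r.
have Dr u v w : bform u (v + w) = bform u v + bform u w.
  by rewrite bformC bformDl !(bformC u).
have Zr k u v : bform u (k *: v) = k * bform u v.
  by rewrite bformC bformZl (bformC u).
by rewrite !(bformDl, Dr, bformZl, Zr) (bformC y x); field.
Qed.

Lemma sipDl x y z : sip n p e (x + y) z = sip n p e x z + sip n p e y z.
Proof. by rewrite !sip_bform bformDl. Qed.

Lemma sipZl k x z : sip n p e (k *: x) z = k * sip n p e x z.
Proof. by rewrite !sip_bform bformZl. Qed.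

Lemma sipC x y : sip n p e x y = sip n p e y x.
Proof. by rewrite !sip_bform bformC. Qed.

Lemma sip_suml (I : finType) (w : I -> R) (a : I -> V) z :
  sip n p e (\sum_i w i *: a i) z = \sum_i w i * sip n p e (a i) z.
Proof.
have s0 : sip n p e 0 z = 0 by rewrite -(scale0r 0) sipZl mul0r.
by elim/big_rec2: _ => // i s x _ <-; rewrite sipDl sipZl.
Qed.

Lemma sip_self x : sip n p e x x = sqnorm (lambda n p e x).
Proof. by rewrite sip_bform sqnorm_bform. Qed.

(** The share of the eigenvalue of index [r] of [x] in [b]: for symmetric
    matrices, the diagonal entry of [b] at an eigenvector of [x], averaged over
    the eigenspace. *)
Definition weight b x (r : 'I_n) : R := residue (lam x) c r (pencil (der b p) e x).

Lemma pencilD q1 q2 x : pencil (q1 + q2) e x = pencil q1 e x + pencil q2 e x.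
Proof. by rewrite /pencil mmapD. Qed.

Lemma weight_sum (I : finType) (a : I -> V) x r :
  weight (\sum_j a j) x r = \sum_j weight (a j) x r.
Proof.
rewrite /weight der_sum.
have res0 : residue (lam x) c r 0 = 0 by rewrite /residue div0p horner0 mul0r.
elim/big_rec2: _ => [|j s q _ <-]; first by rewrite /pencil mmap0.
by rewrite pencilD residueD.
Qed.

(** The derivative of [p] in direction [e] is the derivative of the pencil. *)
Lemma weight_e x r : weight e x r = 1.
Proof.
rewrite /weight -(residue_deriv (lam x) c_neq0 r) -pencil_factor !pencilE.
by rewrite (deriv_mmap idfun (fun i => - coord (vbasis {:V}) i x)).
Qed.

(** The expansion [h = \sum_r weight_r g / (t - lambda_r)] is rewritten for the
    reciprocal polynomials, whose value and first derivative at [0] yield the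
    two sums. *)
Lemma weightP b x : hyp_cone n p e b ->
  [/\ forall r, 0 <= weight b x r,
      \sum_r weight b x r = trace b
    & \sum_r weight b x r * lam x r = sip n p e x b].
Proof.
move=> bcone.
have bneg (tau : R) : tau < 0 -> evalOn p (tau *: e - b) != 0.
  move=> tau0; rewrite evalOn_factor mulf_neq0 //; apply/prodf_neq0 => r _.
  by rewrite subr_eq0 lt_eqF // (lt_le_trans tau0).
pose h := pencil (der b p) e x.
have upper t : 0 < complex.Im t ->
    complex.Im ((map_poly (real_complex R) h).[t]
      * conjc (map_poly (real_complex R) (fullpoly (lam x) c)).[t]) <= 0.
  by rewrite -pencil_factor; apply: (im_dirD_cone p_homog p_real).
have resP r := residue_dvd_ge0 c_neq0 upper r.
have dh : der b p \is n.-1.-homog by apply: dhomog_dirD; rewrite prednK.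
have [sh _] := pencil_top x dh; rewrite prednK // -/h in sh.
have hE := partial_fraction c_neq0 sh (fun r => (resP r).1).
have linE : linpoly (der b p) x =
    \sum_r weight b x r *: (c *: \prod_(r' | r' != r) (1 - lam x r' *: 'X)).
  apply: horner_eq_neq0 => t t0.
  rewrite (horner_linpoly_pencil _ dh) // -/h hE !horner_sum mulr_sumr.
  apply: eq_bigr => r _; rewrite !hornerZ horner_reciprocal //.
  rewrite (eq_card (B := predC1 r)) // cardC1 card_ord /weight -/h mulrCA.
  by congr (_ * _); rewrite mulrCA.
have wsum : \sum_r weight b x r = trace b.
  have := congr1 (fun P : {poly R} => P.[0]) linE.
  rewrite /= linpoly0 horner_sum /trace => ->; rewrite mulr_sumr.
  apply: eq_bigr => r _; rewrite !hornerZ.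
  have [-> _ _] := reciprocal_prod_jet (fun r' => r' != r) (lam x).
  by rewrite mulr1 mulrCA mulVf ?mulr1.
split=> // [r|]; first by case: (resP r).
have := congr1 (fun P : {poly R} => P^`().[0]) linE.
rewrite /= deriv_linpoly hornerN linpoly0 (linear_sum (@deriv R)) horner_sum => dE.
rewrite sip_bform /bform trace_sum -[evalOn (der x _) e]opprK dE -wsum.
rewrite mulr_sumr mulrN opprK.
rewrite mulr_sumr -big_split; apply: eq_bigr => r _ /=.
rewrite !derivZ !hornerZ.
have [_ -> _] := reciprocal_prod_jet (fun r' => r' != r) (lam x).
by rewrite (bigD1 r) //=; field.
Qed.

(** By homogeneity [p (t e - e) = (t - 1) ^+ n * p e], which vanishes only at
    [t = 1]. *)
Lemma hyp_cone_e : hyp_cone n p e e.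
Proof.
move=> r; rewrite leNgt; apply/negP => l0.
have := evalOn_factor e (lam e r); rewrite (bigD1 r) //= subrr mul0r mulr0.
have -> : lam e r *: e - e = (lam e r - 1) *: e by rewrite scalerBl scale1r.
rewrite /evalOn /meval.
have -> : mmap idfun (fun i => coord (vbasis {:V}) i ((lam e r - 1) *: e)) p =
    mmap idfun (fun i => (lam e r - 1) * coord (vbasis {:V}) i e) p.
  by apply: eq_mmap => // i; rewrite linearZ.
rewrite (mmap_homog _ _ _ p_homog) => /eqP; rewrite mulf_eq0 (negbTE c_neq0) orbF.
by rewrite expf_eq0 n_gt0 subr_eq0 => /eqP l1; move: l0; rewrite l1 ltr10.
Qed.

Lemma htr_sum x : htr n p e x = \sum_r lam x r.
Proof.
rewrite /htr; have [_ _ <-] := weightP x hyp_cone_e.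
by apply: eq_bigr => r _; rewrite weight_e mul1r.
Qed.

Lemma htr_trace x : htr n p e x = trace x.
Proof. by rewrite htr_sum trace_sum. Qed.

Lemma sip_ge0 x y : hyp_cone n p e x -> hyp_cone n p e y -> 0 <= sip n p e x y.
Proof.
move=> x0 y0; have [w0 _ <-] := weightP x y0.
by apply: sumr_ge0 => r _; rewrite mulr_ge0.
Qed.

Lemma ds_tuple_matrix (a : 'I_n -> V) x : ds_tuple p e a ->
  exists2 G : 'M[R]_n, ds_matrix G &
    forall j, sip n p e x (a j) = \sum_r G j r * lam x r.
Proof.
case=> a_cone a_tr a_sum; exists (\matrix_(j, r) weight (a j) x r).
  split=> [j r|j|r].
  - by rewrite mxE; have [] := weightP x (a_cone j).
  - under eq_bigr do rewrite mxE.
    by have [_ -> _] := weightP x (a_cone j); rewrite -htr_trace.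
  under eq_bigr do rewrite mxE.
  by rewrite -weight_sum a_sum weight_e.
move=> j; have [_ _ <-] := weightP x (a_cone j).
by apply: eq_bigr => r _; rewrite mxE.
Qed.

(** * Jordan frames *)

Section Frame.
Variable f : 'I_n -> V.
Hypothesis f_frame : jordan_frame n p e f.

Lemma frame_cone i : hyp_cone n p e (f i).
Proof. by move=> r; rewrite f_frame.1 mxE ler0n. Qed.

Lemma frame_tr i : htr n p e (f i) = 1.
Proof.
rewrite htr_sum (bigD1 (Ordinal n_gt0)) //= f_frame.1 mxE eqxx big1 ?addr0 // => r r0.
rewrite mxE (_ : (r == 0%N :> nat) = false) //; apply: contraNF r0 => /eqP r0.
exact/eqP/val_inj.
Qed.

Lemma frame_ds : ds_tuple p e f.
Proof. by split; [apply: frame_cone | apply: frame_tr | case: f_frame]. Qed.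

(** The terms of [\sum_k <f k, f j> = tr (f j) = 1] are nonnegative and the
    diagonal one is already the squared norm [1]. *)
Lemma frame_orthonormal i j : sip n p e (f i) (f j) = (i == j)%:R.
Proof.
have self k : sip n p e (f k) (f k) = 1.
  rewrite sip_self -[RHS](frame_tr k) htr_sum /sqnorm; apply: eq_bigr => r _.
  by rewrite f_frame.1 mxE; case: eqP => _; rewrite ?expr1n ?expr0n.
have row : \sum_k sip n p e (f k) (f j) = 1.
  have eE : e = \sum_k 1 *: f k.
    by rewrite -[LHS]f_frame.2; apply: eq_bigr => k; rewrite scale1r.
  rewrite -(frame_tr j) /htr sipC.
  have := sip_suml (fun=> 1) f (f j); rewrite -eE => ->.
  by apply: eq_bigr => k _; rewrite mul1r.
have [->|ij] := eqVneq i j; first exact: self.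
move: row; rewrite (bigD1 j) //= self -[X in _ = X]addr0 => /addrI row0.
apply: (psumr_eq0P _ row0) => // k _; apply: sip_ge0; exact: frame_cone.
Qed.

Lemma frame_lambda (w : 'I_n -> R) :
  exists2 G : 'M[R]_n, ds_matrix G &
    forall r, lam (\sum_i w i *: f i) r = \sum_j G j r * w j.
Proof.
set x := \sum_i _; have [G Gds GE] := ds_tuple_matrix x frame_ds.
have wE j : sip n p e x (f j) = w j.
  rewrite /x sip_suml (bigD1 j) //= frame_orthonormal eqxx mulr1 big1 ?addr0 // => i ij.
  by rewrite frame_orthonormal (negbTE ij) mulr0.
exists G => //; apply: ds_isometry_transpose => // [j|]; first by rewrite -wE GE.
rewrite -[RHS]/(sqnorm (lambda n p e x)) -sip_self {1}/x sip_suml.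
by apply: eq_bigr => i _; rewrite sipC wE.
Qed.
End Frame.
End HyperbolicSystem.

(** * The theorem *)

Theorem theorem5p7 (R : realType) (V : vectType R) (n : nat) (n_ge2 : (2 <= n)%N)
    (p : polyOn V) (e : V) (hyp : hyperbolic_system n p e)
    (c : 'I_n -> V) (c_frame : jordan_frame n p e c)
    (a : 'I_n -> V) (a_ds : ds_tuple p e a)
    (D : 'M[R]_n) (D_ds : ds_matrix D)
    (T : V -> V)
    (T_def : forall x : V,
       T x = \sum_(i < n) \sum_(j < n) (D i j * sip n p e x (a j)) *: c i) :
  ds_map n p e T /\
  forall x : V, majorized (lambda n p e (T x)) (lambda n p e x).
Proof.
have n_gt0 : (0 < n)%N by apply: ltnW.
pose w x i := \sum_j D i j * sip n p e x (a j).
have TE x : T x = \sum_i w x i *: c i.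
  by rewrite T_def; apply: eq_bigr => i _; rewrite -scaler_suml.
have spectral x : exists2 S : 'M[R]_n, ds_matrix S &
    forall r, lambda n p e (T x) 0 r = \sum_s S r s * lambda n p e x 0 s.
  have [G G_ds GE] := ds_tuple_matrix n_gt0 hyp x a_ds.
  have [H H_ds HE] := frame_lambda n_gt0 hyp c_frame (w x).
  exists (H^T *m (D *m G)).
    exact: ds_matrix_mul (ds_matrix_trmx H_ds) (ds_matrix_mul D_ds G_ds).
  pose l : 'cV[R]_n := \col_s lambda n p e x 0 s.
  move=> r; rewrite TE HE.
  transitivity ((H^T *m (D *m G) *m l) r 0).
    rewrite -!mulmxA mxE; apply: eq_bigr => i _; rewrite mxE; congr (_ * _).
    rewrite mxE /w; apply: eq_bigr => j _; congr (_ * _).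
    by rewrite GE mxE; apply: eq_bigr => s _; rewrite [l _ _]mxE.
  by rewrite mxE; apply: eq_bigr => s _; rewrite [l _ _]mxE.
split; last first.
  move=> x; have [S S_ds SE] := spectral x.
  by apply: (ds_image_majorized S_ds) => // j k; apply: (lambda_dec hyp).
have [a_cone a_tr a_sum] := a_ds; have [D0 Dr Dc] := D_ds.
split.
- move=> k x y; rewrite !TE scaler_sumr -big_split; apply: eq_bigr => i _ /=.
  rewrite scalerA -scalerDl /w mulr_sumr -big_split; congr (_ *: _).
  by apply: eq_bigr => j _ /=; rewrite (sipDl hyp) (sipZl hyp); ring.
- move=> x x0 r; have [S [S0 _ _] ->] := spectral x.
  by apply: sumr_ge0 => s _; rewrite mulr_ge0.
- rewrite TE -[RHS]c_frame.2; apply: eq_bigr => i _.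
  rewrite -[RHS]scale1r -(Dr i); congr (_ *: _); apply: eq_bigr => j _.
  by rewrite (sipC hyp) -/(htr n p e (a j)) a_tr mulr1.
move=> x; rewrite !(htr_sum n_gt0 hyp); have [S [_ _ Sc] SE] := spectral x.
under eq_bigr do rewrite SE.
rewrite exchange_big; apply: eq_bigr => s _ /=.
by rewrite -mulr_suml Sc mul1r.
Qed.
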